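(* Let $x\ge 0$ be fixed, and let $u_0^*>0$ be the unique minimizer over $u>0$ of $u\mapsto h(u)+G\bigl(f(u)\bigr)$ (that is, the unique optimal control of the long-run average cost problem for $X_x^u$ with $p=0$). For $m>0$ let $$u^*(m)=\begin{cases} m & \text{if } m<u_0^*,\\ u_0^* & \text{if } m\ge u_0^*.\end{cases}$$ Then, for every constant $m>0$, the pair $\bigl(X_x^{u^*(m)},L_x^{u^*(m)}\bigr)$ is an optimal process for the constrained problem $$\text{minimize}\quad \limsup_{T\to\infty}\frac1T E\Bigl(\int_0^T\bigl[h(u)+C\bigl(Y^u(t)\bigr)\bigr]\,dt\Bigr)\quad\text{subject to}\quad \limsup_{T\to\infty}\frac{E\bigl(K^u(T)\bigr)}{T}\le m,$$ i.e. it is admissible (with control $u=u^*(m)$) and attains the infimum of the cost over all choices of $u>0$ and all admissible pairs $(Y^u,K^u)$ satisfying the constraint. Furthermore, the optimal control $u^*(m)$ is a continuous increasing (i.e. non-decreasing) function of the parameter $m$.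
   Context: Let $H\in[\tfrac12,1)$ and let $W_H=(W_H(t))_{t\ge 0}$ be a fractional Brownian motion with Hurst parameter $H$: a continuous zero-mean Gaussian process with $W_H(0)=0$ and $\mathrm{Cov}(W_H(s),W_H(t))=\frac12\bigl[t^{2H}+s^{2H}-|t-s|^{2H}\bigr]$ for $s,t\ge 0$. Let $(\mathcal F_t)_{t\ge0}$ be the filtration where $\mathcal F_t$ is the $\sigma$-algebra generated by $\{W_H(s):0\le s\le t\}$ augmented with all null sets. Let $\sigma:[0,\infty)\to(0,\infty)$ be a deterministic continuous function. Given $u>0$, an admissible pair $(Y^u,K^u)$ consists of a non-negative, non-decreasing, right-continuous with left limits, $(\mathcal F_t)$-adapted process $K^u$ with $K^u(0)=0$ and the process $$Y^u(t)=x-ut+\sigma(u)W_H(t)+K^u(t),\qquad t\ge0,$$ such that $Y^u(t)\ge 0$ for all $t\ge 0$. For $x\ge0$, $u\ge0$, $t\ge0$ define $$L_x^u(t)=-\min\Bigl\{0,\min_{s\in[0,t]}\bigl(x-us+\sigma(u)W_H(s)\bigr)\Bigr\},\qquad X_x^u(t)=x-ut+\sigma(u)W_H(t)+L_x^u(t).$$ For $v>0$ put $Z_v=\max_{s\ge 0}\{W_H(s)-vs\}$ and $G(v)=E\bigl(C(Z_v)\bigr)$. Put $f(u)=u/\sigma(u)^{1/H}$. Standing assumptions: $h:[0,\infty)\to[0,\infty)$ is continuous, non-decreasing, strictly convex, with $\lim_{u\to\infty}h(u)=+\infty$; $C:[0,\infty)\to[0,\infty)$ is continuous, non-decreasing,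 convex, and satisfies $C(y)\le K(1+y^\gamma)$ for all $y\ge0$, for some constants $K>0$, $\gamma>0$; $f(u)>0$ for $u>0$, $\lim_{u\to0^+}f(u)=0$, and $f$ is concave and increasing. *)

(* Defs.v *)
From HB Require Import structures.
From mathcomp Require Import all_boot all_order all_algebra.
From mathcomp Require Import all_classical all_reals all_analysis.

Set Implicit Arguments.
Unset Strict Implicit.
Unset Printing Implicit Defensive.

Import Order.TTheory GRing.Theory Num.Theory.
Import numFieldNormedType.Exports.

Local Open Scope classical_set_scope.
Local Open Scope ring_scope.

(* Processes indexed by [0, +oo[ are functions of a time in R; only their
   values at nonnegative times are ever used.  Likewise the functions on
   [0, +oo[ are functions on R constrained on [0, +oo[ only. *)

Section real_functions.
Context {R : realType}.

Definition nondecreasing_on (D : set R) (g : R -> R) :=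
  forall a b, D a -> D b -> a <= b -> g a <= g b.

Definition strictly_convex_on (D : set R) (g : R -> R) :=
  forall a b t, D a -> D b -> a != b -> 0 < t < 1 ->
    g (t * a + (1 - t) * b) < t * g a + (1 - t) * g b.

Definition minimizer (D : set R) (phi : R -> \bar R) (u : R) :=
  D u /\ forall v, D v -> (phi u <= phi v)%E.

Definition limsup_pinfty (g : R -> \bar R) : \bar R :=
  limf_esup g (pinfty_nbhs R).

End real_functions.

Section processes.
Context {d : measure_display} {Omega : measurableType d} {R : realType}.
Variable P : probability Omega R.

(* The degenerate law is treated apart: normal_prob m 0 is not the Dirac mass
   at m. *)
Definition gaussian_rv (X : Omega -> R) :=
  (exists m : R, {ae P, forall w, X w = m}) \/
  (exists m s : R, 0 < s /\
     forall A : set R, measurable A -> P (X @^-1` A) = normal_prob m s A).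

Definition gaussian_process (W : R -> {RV P >-> R}) :=
  forall (n : nat) (t a : 'I_n -> R), (forall i, 0 <= t i) ->
    gaussian_rv (fun w => \sum_(i < n) a i * W (t i) w).

Definition fractional_brownian_motion (H : R) (W : R -> {RV P >-> R}) :=
  [/\ gaussian_process W,
      forall w, W 0 w = 0,
      forall w, {within `[0, +oo[, continuous (fun t => W t w)},
      forall t, 0 <= t -> ('E_P[W t] = 0)%E &
      forall s t, 0 <= s -> 0 <= t ->
        covariance P (W s) (W t) =
        (2^-1 * (t `^ (2 * H) + s `^ (2 * H) - `|t - s| `^ (2 * H)))%:E].

(* P is not assumed complete, so the null sets are all the subsets of
   measurable sets of probability 0. *)
Definition augmented_filtration (W : R -> {RV P >-> R}) (t : R) :
    set (set Omega) :=
  <<s [set A | (exists s, 0 <= s <= t /\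
                  exists2 B : set R, measurable B & A = W s @^-1` B)
               \/ P.-negligible A] >>.

Definition adapted (F : R -> set (set Omega)) (K : R -> Omega -> R) :=
  forall t, 0 <= t -> forall B : set R, measurable B -> F t (K t @^-1` B).

Definition cadlag (k : R -> R) :=
  (forall t, 0 <= t -> k s @[s --> t^'+] --> k t) /\
  (forall t, 0 < t -> cvg (k s @[s --> t^'-])).

Definition netput (W : R -> {RV P >-> R}) (sigma : R -> R) (x u t : R)
    (w : Omega) : R :=
  x - u * t + sigma u * W t w.

Definition admissible (W : R -> {RV P >-> R}) (sigma : R -> R) (x u : R)
    (Y K : R -> Omega -> R) :=
  [/\ forall w, [/\ forall t, 0 <= t -> 0 <= K t w,
                    nondecreasing_on `[0, +oo[ (fun t => K t w),
                    cadlag (fun t => K t w) &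
                    K 0 w = 0],
      adapted (augmented_filtration W) K,
      forall t w, 0 <= t -> Y t w = netput W sigma x u t w + K t w &
      forall t w, 0 <= t -> 0 <= Y t w].

(* The infimum is a minimum, by continuity of the paths of W on `[0, t]. *)
Definition regulator (W : R -> {RV P >-> R}) (sigma : R -> R) (x u t : R)
    (w : Omega) : R :=
  - Num.min 0 (inf [set netput W sigma x u s w | s in `[0, t]]).

Definition reflected (W : R -> {RV P >-> R}) (sigma : R -> R) (x u t : R)
    (w : Omega) : R :=
  netput W sigma x u t w + regulator W sigma x u t w.

(* For v > 0 and a fractional Brownian motion W of Hurst parameter < 1, the
   supremum is almost surely a maximum. *)
Definition max_drifted (W : R -> {RV P >-> R}) (v : R) (w : Omega) : R :=
  sup [set W s w - v * s | s in `[0, +oo[].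

Definition mean_cost (W : R -> {RV P >-> R}) (C : R -> R) (v : R) : \bar R :=
  ('E_P[fun w => C (max_drifted W v w)])%E.

Definition average_cost (h C : R -> R) (u : R) (Y : R -> Omega -> R) :
    \bar R :=
  limsup_pinfty (fun T => (T^-1)%:E *
    \int[P]_w \int[lebesgue_measure]_(t in `[0%R, T]) (h u + C (Y t w))%:E)%E.

Definition average_push (K : R -> Omega -> R) : \bar R :=
  limsup_pinfty (fun T => 'E_P[K T] * (T^-1)%:E)%E.

Definition feasible (W : R -> {RV P >-> R}) (sigma : R -> R) (x m u : R)
    (Y K : R -> Omega -> R) :=
  [/\ 0 < u, admissible W sigma x u Y K & (average_push K <= m%:E)%E].

Definition optimal (W : R -> {RV P >-> R}) (sigma h C : R -> R) (x m u : R)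
    (Y K : R -> Omega -> R) :=
  feasible W sigma x m u Y K /\
  average_cost h C u Y =
    ereal_inf [set c | exists u' Y' K',
      feasible W sigma x m u' Y' K' /\ c = average_cost h C u' Y'].

End processes.

Definition scaled_drift {R : realType} (H : R) (sigma : R -> R) (u : R) : R :=
  u / sigma u `^ H^-1.

Definition constrained_control {R : realType} (u0 m : R) : R :=
  if m < u0 then m else u0.

(* Main.v *)
Require Import Defs.
From HB Require Import structures.
From mathcomp Require Import all_boot all_order all_algebra.
From mathcomp Require Import all_classical all_reals all_analysis.
From mathcomp Require Import measurable_realfun ring lra.

Set Implicit Arguments.
Unset Strict Implicit.
Unset Printing Implicit Defensive.

Import Order.TTheory GRing.Theory Num.Theory.
Import numFieldNormedType.Exports.

Local Open Scope classical_set_scope.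
Local Open Scope ring_scope.

(* For a fixed drift u the Skorokhod regulator is minimal among all admissible
   pushes, so X_x^u has the smallest cost among admissible Y^u.  Time reversal
   and self-similarity identify the law of X_0^u(t) with that of the maximum of
   W_H(s) - f(u) s over [0, t sigma(u)^(1/H)], which increases to Z_(f(u)); as
   X_x^u <= max(X_0^u, x - u t + sigma(u) W_H(t)) and the second term
   contributes a vanishing mean cost, the average cost of X_x^u is
   phi(u) = h(u) + G(f(u)).  Since Y^u >= 0, E K^u(T) >= u T - x, while the
   regulator pushes at most u T + sigma(u) max_[0,T] |W_H|, whose excess over
   u T has mean O(T^H): the constraint amounts to u <= m.  Finally Z_v is convex
   and nonincreasing in v, so that G o f, hence phi, is convex, and phi is
   nonincreasing below its minimizer u_0^*. *)

(** * Integrals and normal laws *)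

(** Two obstacles shape the development. First, [K] is adapted only to the filtration augmented by
    null sets, while [P] is not assumed complete, so [K T] and the cost of [Y] may fail to be
    measurable; comparisons with them are made between nonnegative functions, whose integrals are
    suprema over simple functions and hence monotone. Second, equality in law of two suprema over an
    interval concerns infinitely many coordinates. Continuity of the paths reduces it to countably
    many times, and the joint law of a Gaussian family is recovered from the laws of its linear
    forms through a class of functions generated by cosines, in which indicators of countable
    intersections of half spaces can be built. Growth of the paths comes from dyadic chaining with
    fourth moments: it yields on [0, T] a majorant with mean of order T^H, which both controls the
    push of the regulator and makes Z_v finite almost surely. Costs stay in [\bar R] throughout, so
    that an infinite G(v) is covered. *)

Section lower_integral.
Context d (T : measurableType d) (R : realType).
Variable mu : {measure set T -> \bar R}.
Local Open Scope ereal_scope.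

Import HBNNSimple.

(* No measurability is required: the integral of a nonnegative function is a
   supremum over the simple functions below it. *)
Lemma le_lower_integral (D : set T) (f g : T -> \bar R) :
  (forall x, D x -> 0 <= f x) -> (forall x, D x -> f x <= g x) ->
  \int[mu]_(x in D) f x <= \int[mu]_(x in D) g x.
Proof.
move=> f0 fg; rewrite ge0_integralE// ge0_integralE; last first.
  by move=> x Dx; rewrite (le_trans (f0 x Dx))// fg.
apply: ereal_sup_le => /= _ [h hf <-]; exists h => // x; rewrite (le_trans (hf x))// /patch.
by case: ifPn => //; rewrite inE; exact: fg.
Qed.

End lower_integral.

(** The pushforward bundled with its measure structure, so that it can be rescaled by [mscale] and
    fed to uniqueness theorems for measures. *)
Definition image_measure d d' (T1 : measurableType d) (T2 : measurableType d')
    (R : realType) (mu : {measure set T1 -> \bar R}) (f : T1 -> T2)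
    (mf : measurable_fun [set: T1] f) : {measure set T2 -> \bar R} :=
  measure_function_pushforward__canonical__measure_function_Measure mu mf.

Section affine_lebesgue.
Context {R : realType}.
Local Notation mu := (@lebesgue_measure R).
Implicit Types m s : R.

Lemma measurable_affine m s :
  measurable_fun [set: R] (fun x => m + s * x : R).
Proof. by apply: measurable_funD => //; exact: measurable_funM. Qed.

Lemma affine_preimage_oc m s (a b : R) : 0 < s ->
  (fun x : R => m + s * x) @^-1` `]a, b] = `](a - m) / s, (b - m) / s]%classic.
Proof.
move=> s0; apply/seteqP; split => x /=; rewrite !in_itv/=;
  by rewrite ltr_pdivrMr// ler_pdivlMr// ltrBlDl lerBrDl (mulrC x).
Qed.

Let image_affine m s : {measure set (measurableTypeR R) -> \bar R} :=
  @image_measure _ _ (measurableTypeR R) (measurableTypeR R) _ mu _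
    (@measurable_affine m s).

(** The rescaled pushforward gives every interval []a, b]] its length, and this characterises
    Lebesgue measure. *)
Lemma lebesgue_measure_affine m s (A : set R) : 0 < s -> measurable A ->
  (s%:E * mu ((fun x : R => (m + s * x)%R) @^-1` A))%E = mu A.
Proof.
move=> s0 mA.
pose nu : {measure set _ -> \bar R} :=
  mscale (NngNum (ltW s0)) (image_affine m s).
change (nu A = mu A); apply/esym/lebesgue_measure_unique => // _ [[a b] _ <-].
rewrite [RHS](_ : _ = (s%:E * mu `]((a - m) / s)%R, ((b - m) / s)%R])%E); last first.
  by rewrite -affine_preimage_oc.
rewrite !lebesgue_measure_itv/= !lte_fin ltr_pM2r ?invr_gt0// ltrD2r.
case: ifPn => // ab; last by rewrite mule0.
rewrite -!EFinB -EFinM -mulrBl mulrC divfK ?gt_eqF//; congr EFin; ring.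
Qed.

Lemma ge0_integral_affine m s (f : R -> \bar R) : 0 < s ->
  measurable_fun [set: R] f -> (forall x, (0 <= f x)%E) ->
  (\int[mu]_x f x = s%:E * \int[mu]_x f (m + s * x)%R)%E.
Proof.
move=> s0 mf f0.
have := @ge0_integral_pushforward _ _ (measurableTypeR R) (measurableTypeR R) _ _
  (@measurable_affine m s) mu setT f.
move=> /(_ measurableT mf (fun x _ => f0 x)); rewrite preimage_setT => /= <-.
rewrite -[RHS](@ge0_integral_mscale _ _ _ (image_affine m s) _ measurableT
  (NngNum (ltW s0)) f)//.
by apply: eq_measure_integral => A mA _; rewrite /mscale/= -(lebesgue_measure_affine m s0).
Qed.

End affine_lebesgue.

Section same_law.
Context d1 d2 (T1 : measurableType d1) (T2 : measurableType d2) (R : realType).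
Variables (mu1 : {measure set T1 -> \bar R}) (mu2 : {measure set T2 -> \bar R}).
Variables (X : T1 -> R) (Y : T2 -> R).
Hypotheses (mX : measurable_fun [set: T1] X) (mY : measurable_fun [set: T2] Y).
Hypothesis XY : forall A : set R, measurable A ->
  mu1 (X @^-1` A) = mu2 (Y @^-1` A).

(** The two spaces may differ: typically [X] lives on [Omega] and [Y] is an affine map on the line
    under the standard normal law. *)
Lemma same_law_ge0_integral (f : R -> \bar R) :
  measurable_fun [set: R] f -> (forall x, (0 <= f x)%E) ->
  (\int[mu1]_x f (X x) = \int[mu2]_x f (Y x))%E.
Proof.
move=> mf f0.
have <- := ge0_integral_pushforward mX mu1 measurableT mf (fun x _ => f0 x).
have <- := ge0_integral_pushforward mY mu2 measurableT mf (fun x _ => f0 x).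
by apply: eq_measure_integral => A mA _; exact: XY.
Qed.

Lemma same_law_integral (f : R -> \bar R) : measurable_fun [set: R] f ->
  (\int[mu1]_x f (X x) = \int[mu2]_x f (Y x))%E.
Proof.
move=> mf; rewrite integralE [RHS]integralE; congr (_ - _)%E.
  under eq_integral do rewrite funepos_comp.
  under [RHS]eq_integral do rewrite funepos_comp.
  exact: (same_law_ge0_integral (measurable_funepos mf)).
under eq_integral do rewrite funeneg_comp.
under [RHS]eq_integral do rewrite funeneg_comp.
exact: (same_law_ge0_integral (measurable_funeneg mf)).
Qed.

End same_law.

Section normal_law.
Context {R : realType}.
Local Notation mu := (@lebesgue_measure R).
Implicit Types m s : R.

Lemma normal_pdf_affine m s x : 0 < s ->
  s * normal_pdf m s (m + s * x) = normal_pdf 0 1 x.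
Proof.
move=> s0; rewrite !normal_pdfE ?oner_eq0// ?gt_eqF// mulrA; congr (_ * _).
  rewrite /normal_peak expr1n mul1r -mulrnAr sqrtrM ?sqr_ge0//.
  by rewrite sqrtr_sqr gtr0_norm// invfM mulrA divff ?mul1r// gt_eqF.
rewrite /normal_fun subr0 expr1n addrAC subrr add0r exprMn !mulNr.
congr (expR (- _)); rewrite -[s ^+ 2 *+ 2]mulr_natr.
by field; rewrite gt_eqF.
Qed.

Lemma normal_prob_affine m s (A : set R) : 0 < s -> measurable A ->
  normal_prob m s A = normal_prob 0 1 ((fun x => m + s * x) @^-1` A).
Proof.
move=> s0 mA; rewrite /normal_prob integral_mkcond [RHS]integral_mkcond.
rewrite (@ge0_integral_affine _ m s)//; last 2 first.
  apply/(measurable_restrictT _ _).1 => //; apply/measurable_EFinP.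
  by apply: measurable_funTS; apply: measurable_normal_pdf.
  by apply: erestrict_ge0 => x _; rewrite lee_fin normal_pdf_ge0.
rewrite -ge0_integralZl_EFin ?ltW//; last 2 first.
  move=> x _.
  by apply: (@erestrict_ge0 _ _ _ (fun x => (normal_pdf m s x)%:E)) => y _;
    rewrite lee_fin normal_pdf_ge0.
  apply: measurableT_comp; last exact: measurable_affine.
  apply/(measurable_restrictT _ _).1 => //; apply/measurable_EFinP.
  by apply: measurable_funTS; apply: measurable_normal_pdf.
apply: eq_integral => x _; rewrite !patchE.
have -> : (m + s * x \in A) = (x \in (fun x => m + s * x) @^-1` A).
  by apply/idP/idP; rewrite !inE.
by case: ifPn => _; rewrite ?mule0// -EFinM normal_pdf_affine.
Qed.

(** Change of variables holds with the Radon-Nikodym derivative, which agrees almost everywhere with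
    the density because both have the same integrals over measurable sets. *)
Lemma integral_normal_prob m s (f : R -> \bar R) :
  measurable_fun [set: R] f -> (forall x, (0 <= f x)%E) ->
  (\int[normal_prob m s]_x f x = \int[mu]_x (f x * (normal_pdf m s x)%:E))%E.
Proof.
move=> mf f0.
have nu_mu := @normal_prob_dominates R m s.
rewrite -(Radon_Nikodym_SigmaFinite.change_of_variables nu_mu f0 measurableT mf).
have mRN := measurable_int _ (Radon_Nikodym_SigmaFinite.f_integrable nu_mu).
have mpdf : measurable_fun [set: R] (EFin \o normal_pdf m s).
  by apply/measurable_EFinP; exact: measurable_normal_pdf.
apply: ae_eq_integral => //.
- exact: emeasurable_funM.
- exact: emeasurable_funM.
- apply: ae_eqe_mul2l; apply: integral_ae_eq => //.
    exact: Radon_Nikodym_SigmaFinite.f_integrable.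
  by move=> A _ mA; rewrite -Radon_Nikodym_SigmaFinite.f_integral.
Qed.

Lemma exprn_le_expR n (y : R) : 0 <= y -> y ^+ n <= n`!%:R * expR y.
Proof.
move=> y0; case: n => [|n]; first by rewrite expr0 fact0 mul1r -expR0 ler_expR.
rewrite -ler_pdivrMl ?ltr0n ?fact_gt0// mulrC.
by rewrite (le_trans _ (expR_ge1Dxn n y0))// lerDr.
Qed.

(** Half of the Gaussian exponent absorbs the power: |x|^p exp(-x^2/4) is bounded, and the remaining
    exp(-x^2/4) is, up to a constant, the density of variance 2. *)
Lemma normal_moment_lty p :
  (\int[normal_prob 0 1]_x (`|x : R| ^+ p)%:E < +oo)%E.
Proof.
(* The 1 serves |x| <= 1; for |x| > 1, |x|^p <= 4^p (x^2/4)^p <= 4^p p! exp(x^2/4). *)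
pose c : R := 1 + (4 ^+ p) * p`!%:R.
pose q : R := Num.sqrt 2.
have q0 : q != 0 by rewrite gt_eqF// sqrtr_gt0.
have bound (x : R) : `|x| ^+ p * normal_pdf 0 1 x <=
    (c * normal_peak 1 / normal_peak q) * normal_pdf 0 q x.
  rewrite !normal_pdfE ?oner_eq0//.
  have -> : c * normal_peak 1 / normal_peak q * (normal_peak q * normal_fun 0 q x) =
      normal_peak 1 * (c * normal_fun 0 q x).
    by field; rewrite gt_eqF// normal_peak_gt0.
  rewrite mulrCA ler_wpM2l ?normal_peak_ge0//.
  have -> : normal_fun 0 1 x = normal_fun 0 q x * normal_fun 0 q x.
    rewrite /normal_fun -expRD subr0 expr1n sqr_sqrtr//; congr expR.
    by field.
  rewrite mulrA ler_wpM2r ?normal_fun_ge0//.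
  have y0 : 0 <= x ^+ 2 / 4 by rewrite divr_ge0 ?sqr_ge0.
  have -> : normal_fun 0 q x = (expR (x ^+ 2 / 4))^-1.
    rewrite /normal_fun -expRN subr0 sqr_sqrtr//; congr expR.
    by field.
  rewrite ler_pdivrMr ?expR_gt0// /c mulrDl mul1r.
  have [x1|x1] := lerP `|x| 1.
    apply: (@le_trans _ _ 1); first by rewrite exprn_ile1.
    apply: (@le_trans _ _ (expR (x ^+ 2 / 4))); first by rewrite -[leLHS]expR0 ler_expR.
    by rewrite lerDl !mulr_ge0 ?exprn_ge0 ?expR_ge0.
  apply: (@le_trans _ _ ((x ^+ 2) ^+ p)).
    rewrite -(real_normK (num_real x)) -exprM.
    by rewrite (ler_weXn2l (ltW x1))// leq_pmull.
  apply: ler_wpDl; first exact: expR_ge0.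
  rewrite {1}(_ : x ^+ 2 = 4 * (x ^+ 2 / 4)); last by field.
  by rewrite exprMn -[leRHS]mulrA ler_pM2l ?exprn_gt0// exprn_le_expR.
have c0 : 0 <= c by rewrite addr_ge0// mulr_ge0// exprn_ge0.
have mabs : measurable_fun [set: R] (fun x : R => (`|x| ^+ p)%:E).
  by apply/measurable_EFinP; apply: measurable_funX.
rewrite integral_normal_prob//.
apply: (@le_lt_trans _ _ (\int[mu]_x
    (c * normal_peak 1 / normal_peak q * normal_pdf 0 q x)%:E)%E).
  apply: le_lower_integral => x _; rewrite -EFinM lee_fin ?bound//.
  by rewrite mulr_ge0 ?normal_pdf_ge0// exprn_ge0.
under eq_integral do rewrite EFinM.
rewrite ge0_integralZl_EFin//.
- by rewrite integral_normal_pdf mule1 ltry.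
- by move=> x _; rewrite lee_fin normal_pdf_ge0.
- by apply/measurable_EFinP; exact: measurable_normal_pdf.
- by rewrite !mulr_ge0 ?invr_ge0 ?normal_peak_ge0.
Qed.

End normal_law.

(** * Moments and laws of centred Gaussian variables *)

Section gaussian_moments.
Context {R : realType}.
Local Notation N := (normal_prob (0 : R) 1).

Lemma exprD_le (a b : R) n : 0 <= a -> 0 <= b ->
  (a + b) ^+ n <= 2 ^+ n * (a ^+ n + b ^+ n).
Proof.
move=> a0 b0.
have [ab|ba] := leP a b.
- apply: (@le_trans _ _ ((2 * b) ^+ n)).
    by apply: lerXn2r; rewrite ?nnegrE ?addr_ge0 ?mulr_ge0//; lra.
  by rewrite exprMn ler_wpM2l ?exprn_ge0// lerDr exprn_ge0.
- apply: (@le_trans _ _ ((2 * a) ^+ n)).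
    by apply: lerXn2r; rewrite ?nnegrE ?addr_ge0 ?mulr_ge0//; lra.
  by rewrite exprMn ler_wpM2l ?exprn_ge0// lerDl exprn_ge0.
Qed.

Let mnormX (c : R) p : measurable_fun [set: R] (fun x : R => `|x - c| ^+ p).
Proof.
by apply: measurable_funX; apply: measurableT_comp => //; exact: measurable_funB.
Qed.

(** Kept as a symbol: centred laws are written below as images of N under
    [s * (x - normal_mean)]. *)
Definition normal_mean : R := fine (\int[N]_x x%:E).

Definition normal_cmoment p : R :=
  fine (\int[N]_x (`|x - normal_mean| ^+ p)%:E).

Lemma normal_cmomentE p :
  (\int[N]_x (`|x - normal_mean| ^+ p)%:E = (normal_cmoment p)%:E)%E.
Proof.
rewrite fineK// ge0_fin_numE; last first.
  by apply: integral_ge0 => x _; rewrite lee_fin exprn_ge0.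
apply: (@le_lt_trans _ _ (\int[N]_x
    ((2 ^+ p)%:E * ((`|x| ^+ p)%:E + (`|normal_mean| ^+ p)%:E)))%E).
  apply: ge0_le_integral => //=.
  - by apply/measurable_EFinP; exact: mnormX.
  - apply/measurable_EFinP; apply: measurable_funM => //.
    by apply: measurable_funD => //; exact: measurable_funX.
  - move=> x _; rewrite lee_fin; apply: le_trans (exprD_le p _ _) => //.
    by rewrite lerXn2r ?nnegrE ?addr_ge0// ler_normB.
have mX : measurable_fun [set: R] (fun x : R => (`|x| ^+ p)%:E).
  by apply/measurable_EFinP; apply: measurable_funX.
rewrite ge0_integralZl_EFin ?exprn_ge0//; last 2 first.
- by move=> x _; rewrite adde_ge0// lee_fin exprn_ge0.
- exact: emeasurable_funD.
rewrite lte_mul_pinfty ?lee_fin ?exprn_ge0// ge0_integralD//.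
rewrite lte_add_pinfty ?normal_moment_lty// integral_cst//.
by rewrite [X in (_ * X)%E](@probability_setT _ _ _ N) mule1 ltry.
Qed.

Lemma normal_integrable_id : N.-integrable setT (fun x : R => x%:E).
Proof.
apply/integrableP; split; first by apply/measurable_EFinP.
apply: (le_lt_trans _ (@normal_moment_lty R 1%N)).
by apply: le_lower_integral => // x _; rewrite expr1.
Qed.

Lemma normal_cmoment_ge0 p : 0 <= normal_cmoment p.
Proof.
rewrite -lee_fin -normal_cmomentE.
by apply: integral_ge0 => x _; rewrite lee_fin exprn_ge0.
Qed.

(** With a zero variance N would be concentrated at its mean, whereas a point is null for Lebesgue
    measure and therefore for N. *)
Lemma normal_cmoment2_gt0 : 0 < normal_cmoment 2.
Proof.
rewrite lt_neqAle normal_cmoment_ge0 andbT eq_sym; apply/eqP => c0.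
have := normal_cmomentE 2; rewrite c0.
have mf : measurable_fun [set: R] (fun x : R => (`|x - normal_mean| ^+ 2)%:E).
  by apply/measurable_EFinP; exact: mnormX.
move=> int0; have [_ N0] := ae_eq_integral_abs N measurableT mf.
have : ae_eq N setT (fun x : R => (`|x - normal_mean| ^+ 2)%:E) (cst 0%E).
  apply/(ae_eq_integral_abs N measurableT mf).
  by under eq_integral do rewrite gee0_abs ?lee_fin ?exprn_ge0//.
move=> [A [mA NA0 subA]].
have : N setT = 0%E.
  have -> : [set: R] = A `|` [set normal_mean].
    apply/seteqP; split => // x _.
    have [->|xm] := eqVneq x normal_mean; [by right|left].
    apply: subA => /= /(_ I) /eqP.
    by rewrite eqe expf_eq0/= normr_eq0 subr_eq0 (negbTE xm).
  have N1 : N [set normal_mean] = 0%E.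
    have /null_content_dominatesP := @normal_prob_dominates R 0 1.
    by apply => //; exact: lebesgue_measure_set1.
  apply/eqP; rewrite -measure_le0; apply: (le_trans (measureU2 _ _ _)) => //.
  by rewrite [X in (X + _)%E]NA0 [X in (_ + X)%E]N1 adde0.
by rewrite (@probability_setT _ _ _ N) => /eqP; rewrite onee_eq0.
Qed.

End gaussian_moments.

Lemma probability_integral_cst d (T : measurableType d) (R : realType)
  (P : probability T R) (c : R) : (\int[P]_x c%:E = c%:E)%E.
Proof. by rewrite integral_cst// [X in (_ * X)%E]probability_setT mule1. Qed.

Section centered_gaussian.
Context d (Omega : measurableType d) (R : realType) (P : probability Omega R).
Local Notation N := (normal_prob (0 : R) 1).
Local Notation scaled s := (fun x : R => s * (x - normal_mean)).

Let mscaled (s : R) : measurable_fun [set: R] (scaled s).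
Proof. by apply: measurable_funM => //; exact: measurable_funB. Qed.

(** Merges the two cases of [gaussian_rv] into one form: a constant variable takes [s = 0], and in
    the normal case E X = 0 forces [m = - s * normal_mean]. *)
Lemma gaussian_rv_scaled (X : Omega -> R) : measurable_fun [set: Omega] X ->
  gaussian_rv P X -> (\int[P]_w (X w)%:E = 0)%E ->
  exists2 s : R, 0 <= s &
    forall A : set R, measurable A -> P (X @^-1` A) = N (scaled s @^-1` A).
Proof.
move=> mX [[m Xm] X0|[m [s [s0 Xms]]] X0].
- exists 0 => // A mA.
  have mXE : measurable_fun [set: Omega] (EFin \o X) by exact/measurable_EFinP.
  have m0 : m = 0.
    have [] // : m%:E = 0%E.
    rewrite -X0 (ae_eq_integral (cst m%:E))//.
      by rewrite probability_integral_cst.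
    by case: Xm => M [mM M0 MX]; exists M; split => // w /= Xw; apply: MX => /= Xwm;
      apply: Xw => _; rewrite Xwm.
  have mXA : measurable (X @^-1` A) by rewrite -[_ @^-1` _]setTI; exact: mX.
  have -> : scaled 0 @^-1` A = if 0 \in A then setT else set0.
    case: ifPn => A0; apply/seteqP; split => x //=; rewrite mul0r.
      by move=> _; exact: set_mem A0.
    by move=> /mem_set; rewrite (negbTE A0).
  (* [X] is constant only almost surely, so the probability is computed as the integral of an
     indicator that is almost everywhere constant. *)
  transitivity (\int[P]_w (\1_(X @^-1` A) w)%:E)%E.
    by rewrite integral_indic// setIT.
  rewrite (ae_eq_integral (cst (0 \in A)%:R%:E))//.
  + rewrite probability_integral_cst.
    case: ifPn => _; last by rewrite measure0.
    by rewrite (@probability_setT _ _ _ N).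
  + by apply/measurable_EFinP; exact: measurable_indic.
  + case: Xm => M [mM M0 MX]; exists M; split => // w /= Xw; apply: MX => /= Xwm.
    apply: Xw => _; rewrite indicE.
    have -> // : (w \in X @^-1` A) = (0 \in A).
    by apply/idP/idP; rewrite !inE/= Xwm m0.
- have mN := normal_integrable_id (R := R).
  have law (A : set R) : measurable A ->
      P (X @^-1` A) = N ((fun x => m + s * x) @^-1` A).
    by move=> mA; exact: etrans (Xms _ mA) (normal_prob_affine _ s0 mA).
  have mE : measurable_fun [set: R] (@EFin R) by apply/measurable_EFinP.
  have := @same_law_integral _ _ _ _ _ P N _ _ mX (@measurable_affine R m s) law
    EFin mE.
  rewrite X0.
  have Nfin := integrable_fin_num measurableT mN.
  have -> : (\int[N]_x (m + s * x)%:E = (m + s * normal_mean)%:E)%E.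
    under eq_integral do rewrite EFinD EFinM.
    rewrite integralD//=; last 2 first.
    - exact: finite_measure_integrable_cst.
    - exact: integrableZl.
    rewrite (probability_integral_cst N).
    by rewrite integralZl// EFinD EFinM /normal_mean fineK.
  move=> -[m0]; exists s; first exact: ltW.
  move=> A mA; rewrite law//; congr (N _).
  have -> // : (fun x => m + s * x) = scaled s.
  by apply/funext => x; rewrite -[RHS]add0r m0; ring.
Qed.

Let scaled_moment (X : Omega -> R) (s : R) p : measurable_fun [set: Omega] X ->
  0 <= s ->
  (forall A : set R, measurable A -> P (X @^-1` A) = N (scaled s @^-1` A)) ->
  (\int[P]_w (`|X w| ^+ p)%:E = (s ^+ p * normal_cmoment p)%:E)%E.
Proof.
move=> mX s0 law.
have mE : measurable_fun [set: R] (fun x : R => (`|x| ^+ p)%:E).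
  by apply/measurable_EFinP; apply: measurable_funX.
rewrite (@same_law_integral _ _ _ _ _ P N _ _ mX (mscaled s) law _ mE).
under eq_integral do rewrite normrM exprMn (ger0_norm s0) EFinM.
rewrite ge0_integralZl_EFin ?exprn_ge0//.
- by rewrite normal_cmomentE.
- apply/measurable_EFinP; apply: measurable_funX.
  by apply: measurableT_comp => //; exact: measurable_funB.
Qed.

(** The p-th absolute moment of a standardised Gaussian variable, E|X|^p / (E X^2)^(p/2), which does
    not depend on the scale. *)
Definition gaussian_ratio p : R :=
  normal_cmoment p / Num.sqrt (normal_cmoment 2) ^+ p.

Lemma gaussian_ratio_ge0 p : 0 <= gaussian_ratio p.
Proof. by rewrite divr_ge0 ?normal_cmoment_ge0// exprn_ge0. Qed.

Let scaled_scale (X : Omega -> R) (s r : R) : measurable_fun [set: Omega] X ->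
  0 <= s -> 0 <= r ->
  (forall A : set R, measurable A -> P (X @^-1` A) = N (scaled s @^-1` A)) ->
  (\int[P]_w (X w ^+ 2)%:E = (r ^+ 2)%:E)%E ->
  s = r / Num.sqrt (normal_cmoment 2).
Proof.
move=> mX s0 r0 law X2; have c0 := @normal_cmoment2_gt0 R.
have := scaled_moment 2 mX s0 law.
under eq_integral do rewrite real_normK ?num_real//.
rewrite X2 => -[rs]; apply/eqP; rewrite -(@eqrXn2 _ 2%N)//; last first.
  by rewrite divr_ge0.
by rewrite expr_div_n sqr_sqrtr ?ltW// rs mulfK// gt_eqF.
Qed.

Lemma gaussian_rv_moment (X : Omega -> R) (r : R) p :
  measurable_fun [set: Omega] X -> gaussian_rv P X ->
  (\int[P]_w (X w)%:E = 0)%E -> 0 <= r ->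
  (\int[P]_w (X w ^+ 2)%:E = (r ^+ 2)%:E)%E ->
  (\int[P]_w (`|X w| ^+ p)%:E = (gaussian_ratio p * r ^+ p)%:E)%E.
Proof.
move=> mX gX X0 r0 X2; have [s s0 law] := gaussian_rv_scaled mX gX X0.
rewrite (scaled_moment p mX s0 law) (scaled_scale mX s0 r0 law X2).
by congr EFin; rewrite expr_div_n /gaussian_ratio; ring.
Qed.

Lemma gaussian_rv_moment_lty (X : Omega -> R) p :
  measurable_fun [set: Omega] X -> gaussian_rv P X ->
  (\int[P]_w (X w)%:E = 0)%E -> (\int[P]_w (`|X w| ^+ p)%:E < +oo)%E.
Proof.
move=> mX gX X0; have [s s0 law] := gaussian_rv_scaled mX gX X0.
by rewrite (scaled_moment p mX s0 law) ltry.
Qed.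

(** Both laws are scaled copies of the centred N, and the second moment determines the scale. *)
Lemma gaussian_rv_law (X Y : Omega -> R) :
  measurable_fun [set: Omega] X -> measurable_fun [set: Omega] Y ->
  gaussian_rv P X -> gaussian_rv P Y ->
  (\int[P]_w (X w)%:E = 0)%E -> (\int[P]_w (Y w)%:E = 0)%E ->
  (\int[P]_w (X w ^+ 2)%:E = \int[P]_w (Y w ^+ 2)%:E)%E ->
  forall A : set R, measurable A -> P (X @^-1` A) = P (Y @^-1` A).
Proof.
move=> mX mY gX gY X0 Y0 XY A mA.
have [s s0 lawX] := gaussian_rv_scaled mX gX X0.
have [t t0 lawY] := gaussian_rv_scaled mY gY Y0.
pose r := Num.sqrt (fine (\int[P]_w (Y w ^+ 2)%:E)%E).
have Y2 : (\int[P]_w (Y w ^+ 2)%:E = (r ^+ 2)%:E)%E.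
  have Y2ge0 : (0 <= \int[P]_w (Y w ^+ 2)%:E)%E.
    by apply: integral_ge0 => w _; rewrite lee_fin sqr_ge0.
  rewrite sqr_sqrtr ?fine_ge0// fineK// ge0_fin_numE//.
  have := gaussian_rv_moment_lty 2 mY gY Y0.
  by under eq_integral do rewrite real_normK ?num_real//.
rewrite lawX// lawY// (scaled_scale mX s0 (sqrtr_ge0 _) lawX (etrans XY Y2)).
by rewrite (scaled_scale mY t0 (sqrtr_ge0 _) lawY Y2).
Qed.

End centered_gaussian.

(** * Laws of Gaussian families *)

Section trigonometric_class.
Context {I : Type} {R : realType}.

Definition linform (s : seq (R * I)) (x : I -> R) : R :=
  \sum_(p <- s) p.1 * x p.2.

Lemma linform_cat s t x : linform (s ++ t) x = linform s x + linform t x.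
Proof. by rewrite /linform big_cat. Qed.

Lemma linform_opp s x :
  linform [seq (- p.1, p.2) | p <- s] x = - linform s x.
Proof.
by rewrite /linform big_map/= -sumrN; apply: eq_bigr => p _; rewrite mulNr.
Qed.

(* The functions of a family whose mean is determined by the laws of the finite
   linear combinations of the family.  Closure under products, hence under the
   limit of [iter k cube], makes indicator functions reachable. *)
Inductive trig : ((I -> R) -> R) -> Prop :=
| trig_cos s c : trig (fun x => cos (linform s x + c))
| trig_lin F G a b : trig F -> trig G -> trig (fun x => a * F x + b * G x)
| trig_lim F G B : (forall k : nat, trig (F k)) ->
    (forall k x, `|F k x| <= B) ->
    (forall x, F k x @[k --> \oo] --> G x) -> trig G.

Lemma trig_ext F G : trig F -> F =1 G -> trig G.
Proof. by move=> tF /funext <-. Qed.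

Lemma trig_bounded F : trig F -> exists B, forall x, `|F x| <= B.
Proof.
elim=> [s c|{}F G a b _ [A FA] _ [B GB]|{}F G B _ _ FB FG].
- by exists 1 => x; rewrite ler_norml cos_geN1 cos_le1.
- exists (`|a| * A + `|b| * B) => x; rewrite (le_trans (ler_normD _ _))// !normrM.
  by rewrite lerD// ler_wpM2l.
- exists B => x; have Gx : `|F k x| @[k --> \oo] --> `|G x| by exact: cvg_norm.
  by apply: (cvgr_to_le Gx); apply: nearW => k; exact: FB.
Qed.

Lemma trig_cst a : trig (fun=> a).
Proof.
apply: (trig_ext (trig_lin a 0 (trig_cos [::] 0) (trig_cos [::] 0))) => x.
by rewrite /linform big_nil addr0 cos0 mulr1 mul0r addr0.
Qed.

Lemma trig_scale a F : trig F -> trig (fun x => a * F x).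
Proof.
move=> tF; apply: (trig_ext (trig_lin a 0 tF tF)) => x.
by rewrite mul0r addr0.
Qed.

Lemma trig_sub F G : trig F -> trig G -> trig (fun x => F x - G x).
Proof.
move=> tF tG; apply: (trig_ext (trig_lin 1 (-1) tF tG)) => x.
by rewrite mul1r mulN1r.
Qed.

Lemma trig_mul F G : trig F -> trig G -> trig (fun x => F x * G x).
Proof.
(* The induction is done on one factor at a time: here the other one is a single cosine, and two
   cosines are multiplied by the product-to-sum formula. *)
have cosF s c H : trig H -> trig (fun x => cos (linform s x + c) * H x).
  elim=> [t e|{}F {}G a b _ tF _ tG|{}F {}G B tF ihF FB FG].
  - apply: (trig_ext (trig_lin 2^-1 2^-1 (trig_cos (s ++ t) (c + e))
      (trig_cos (s ++ [seq (- p.1, p.2) | p <- t]) (c - e)))) => x.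
    rewrite !linform_cat linform_opp.
    have -> : linform s x + linform t x + (c + e) =
      (linform s x + c) + (linform t x + e) by ring.
    have -> : linform s x - linform t x + (c - e) =
      (linform s x + c) - (linform t x + e) by ring.
    by rewrite cosD cosB; field.
  - by apply: (trig_ext (trig_lin a b tF tG)) => x; ring.
  - apply: (trig_lim (B := B) ihF) => [k x|x].
      rewrite normrM -[leRHS]mul1r ler_pM// ler_norml cos_geN1 cos_le1//.
    by apply: cvgM (FG x); exact: cvg_cst.
move=> + tG; elim=> [t e|{}F {}H a b _ tF _ tH|{}F {}H B tF ihF FB FG].
- exact: cosF.
- by apply: (trig_ext (trig_lin a b tF tH)) => x; ring.
- have [C GC] := trig_bounded tG.
  apply: (trig_lim (B := B * C) ihF) => [k x|x].
    by rewrite normrM ler_pM.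
  by apply: cvgM (FG x) _; exact: cvg_cst.
Qed.

(* Its iterates converge on [-1, 1] to the sign function. *)
Let cube (y : R) := (3 * y - y ^+ 3) / 2.

Lemma trig_cube F : trig F -> trig (fun x => cube (F x)).
Proof.
move=> tF; apply: (trig_ext (trig_lin (3 / 2) (- 2^-1) tF
  (trig_mul tF (trig_mul tF tF)))) => x; rewrite /cube.
by field.
Qed.

Let cube_itv (y : R) : -1 <= y <= 1 -> -1 <= cube y <= 1.
Proof.
move=> /andP[y1 y2].
have e1 : 1 - cube y = (1 - y) ^+ 2 * (2 + y) / 2 by rewrite /cube; field.
have e2 : 1 + cube y = (1 + y) ^+ 2 * (2 - y) / 2 by rewrite /cube; field.
have : 0 <= 1 - cube y by rewrite e1 divr_ge0// mulr_ge0 ?sqr_ge0//; lra.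
have : 0 <= 1 + cube y by rewrite e2 divr_ge0// mulr_ge0 ?sqr_ge0//; lra.
lra.
Qed.

Let cube_iter_itv k (y : R) : -1 <= y <= 1 -> -1 <= iter k cube y <= 1.
Proof. by move=> y1; elim: k => //= k; exact: cube_itv. Qed.

Let cube_iter_opp k y : iter k cube (- y) = - iter k cube y.
Proof. by elim: k => //= k ->; rewrite /cube; ring. Qed.

(** Iterating increases [z] towards 1, and 1 - cube z = (1 - z)(1 - z(1 + z)/2), whose second factor
    is at most 1 - y/2 as soon as z >= y. *)
Let cube_iter_lb k y : 0 < y <= 1 ->
  y <= iter k cube y /\ 1 - iter k cube y <= (1 - y / 2) ^+ k.
Proof.
move=> /andP[y0 y1]; elim: k => [|k [ih1 ih2]]/=; first by rewrite expr0; lra.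
have /andP[_ z1] := @cube_iter_itv k y ltac:(lra).
set z := iter k cube y in ih1 ih2 z1 *.
have cz : 1 - cube z = (1 - z) * (1 - z * (1 + z) / 2) by rewrite /cube; field.
split; first by apply: (le_trans ih1); rewrite /cube; nra.
rewrite cz exprS mulrC; apply: ler_pM => //; [nra|lra|nra].
Qed.

Let cube_iter_sg y : -1 <= y <= 1 -> iter k cube y @[k --> \oo] --> Num.sg y.
Proof.
have pos z : 0 < z <= 1 -> iter k cube z @[k --> \oo] --> (1 : R).
  move=> z01; apply/cvgrPdist_le => e e0.
  have /cvgrPdist_le : (1 - z / 2) ^+ k @[k --> \oo] --> (0 : R).
    by apply: cvg_expr; rewrite ger0_norm; lra.
  move=> /(_ _ e0); apply: filterS => k.
  have [_ k2] := cube_iter_lb k z01.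
  have /andP[_ k1] := @cube_iter_itv k z ltac:(lra).
  rewrite sub0r normrN; apply: le_trans.
  by rewrite ger0_norm ?subr_ge0// (le_trans k2)// ler_norm.
move=> y1; have [y0|y0|->] := ltgtP y 0.
- rewrite ltr0_sg//.
  have -> : (fun k => iter k cube y) = (fun k => - iter k cube (- y)).
    by apply/funext => k; rewrite cube_iter_opp opprK.
  by apply: cvgN; apply: pos; lra.
- by rewrite gtr0_sg//; apply: pos; lra.
- rewrite sgr0; have -> : (fun k => iter k cube 0) = cst (0 : R).
    by apply/funext; elim=> //= k ->; rewrite /cube; ring.
  exact: cvg_cst.
Qed.

(** A sine is a shifted cosine with values in [-1, 1], so iterating [cube] yields its sign. Once the
    period is large enough, the sine of [(x i - b) / M.+1] has the sign of [x i - b]. *)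
Lemma trig_sg (i : I) (b : R) : trig (fun x => Num.sg (x i - b)).
Proof.
pose s (M : nat) (x : I -> R) : R := sin ((x i - b) / M.+1%:R).
have ts M : trig (s M).
  apply: (trig_ext (trig_scale (-1)
    (trig_cos [:: (M.+1%:R^-1, i)] (- b / M.+1%:R + pi / 2)))) => x.
  rewrite /linform big_seq1/= addrA cosDpihalf mulN1r opprK /s.
  by congr sin; ring.
have sg_s M : trig (fun x => Num.sg (s M x)).
  apply: (@trig_lim (fun k x => iter k cube (s M x)) _ 1).
  - by elim=> //= k tk; exact: trig_cube.
  - move=> k x; rewrite ler_norml; apply: cube_iter_itv.
    by rewrite /s sin_geN1 sin_le1.
  - by move=> x; apply: cube_iter_sg; rewrite /s sin_geN1 sin_le1.
apply: (@trig_lim (fun M x => Num.sg (s M x)) _ 1) => // [M x|x].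
  by rewrite normr_sg; case: (_ != _).
apply: cvg_near_cst; near=> M.
rewrite /s; set y := x i - b.
have My : `|y / M.+1%:R| < pi.
  rewrite normrM (gtr0_norm (x := _^-1)) ?invr_gt0// ltr_pdivrMr// -ltr_pdivrMl ?pi_gt0//.
  apply: (@lt_le_trans _ _ M%:R); last by rewrite ler_nat.
  by near: M; exact: nbhs_infty_gtr.
have M0 : 0 < M.+1%:R :> R by rewrite ltr0n.
have [y0|y0|->] := ltgtP y 0.
- rewrite (ltr0_sg y0) ltr0_sg// -oppr_gt0 -sinN sin_gt0_pi// -mulNr.
  by rewrite divr_gt0 ?oppr_gt0//= mulNr (le_lt_trans _ My)// -normrN ler_norm.
- rewrite (gtr0_sg y0) gtr0_sg// sin_gt0_pi// divr_gt0//=.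
  by rewrite (le_lt_trans _ My)// ler_norm.
- by rewrite mul0r sin0 sgr0.
Unshelve. all: by end_near. Qed.

Lemma trig_le (i : I) (b : R) : trig (fun x => (x i <= b)%R%:R).
Proof.
have ts := trig_sg i b.
(* For a sign s in {-1, 0, 1}, the indicator of s <= 0 is 1 - (s + s^2)/2. *)
apply: (trig_ext (trig_sub (trig_cst 1)
  (trig_lin 2^-1 2^-1 ts (trig_mul ts ts)))) => x.
have [xb|xb|->] := ltgtP (x i) b.
- by rewrite ltr0_sg ?subr_lt0//=; ring.
- by rewrite gtr0_sg ?subr_gt0//=; field.
- by rewrite subrr sgr0/=; ring.
Qed.

(** A bounded limit of finite products of indicators. Countably many constraints are exactly what a
    bound on a continuous path over an interval amounts to. *)
Lemma trig_forall_le (i : nat -> I) (b : nat -> R) :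
  trig (fun x => \1_[set x : I -> R | forall k, x (i k) <= b k] x).
Proof.
pose F (n : nat) (x : I -> R) : R := \prod_(k < n) (x (i k) <= b k)%R%:R.
have F01 n x : F n x = [forall k : 'I_n, x (i k) <= b k]%:R.
  rewrite /F; case: forallP => [xb|/existsNP[k /negP xk]].
    by rewrite big1// => k _; rewrite xb.
  by rewrite (bigD1 k)//= (negbTE xk) mul0r.
have tF n : trig (F n).
  elim: n => [|n ih].
    by apply: (trig_ext (trig_cst 1)) => x; rewrite /F big_ord0.
  apply: (trig_ext (trig_mul ih (trig_le (i n) (b n)))) => x.
  by rewrite /F big_ord_recr.
apply: (@trig_lim F _ 1) => // [n x|x].
  by rewrite F01 ger0_norm//; case: [forall _, _].
apply: cvg_near_cst; have [xb|/existsNP[k /negP xk]] := pselect (forall k, x (i k) <= b k).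
  apply: nearW => n; rewrite F01 indicE mem_set//.
  by case: forallP => // -[] k.
near=> n; rewrite F01 indicE memNset/=; last first.
  by move=> /(_ k); exact/negP.
have kn : (k < n)%N by near: n; exact: nbhs_infty_gt.
by case: forallP => // /(_ (Ordinal kn))/=; rewrite (negbTE xk).
Unshelve. all: by end_near. Qed.

End trigonometric_class.

Lemma measurable_cos (R : realType) : measurable_fun [set: R] (@cos R).
Proof. by apply: continuous_measurable_fun; exact: continuous_cos. Qed.

Section law_from_linear_forms.
Context d (Omega : measurableType d) (R : realType) (P : probability Omega R).
Context {I : Type}.
Implicit Types U V : I -> Omega -> R.

Lemma trig_measurable U F : (forall i, measurable_fun [set: Omega] (U i)) ->
  trig F -> measurable_fun [set: Omega] (fun w => F (U^~ w)).
Proof.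
move=> mU; elim=> [s c|{}F G a b _ mF _ mG|{}F G B _ mF _ FG].
- apply: measurableT_comp; first exact: measurable_cos.
  apply: measurable_funD => //; elim: s => [|p s ih].
    by under eq_fun do rewrite /linform big_nil; exact: measurable_cst.
  under eq_fun do rewrite /linform big_cons.
  by apply: measurable_funD => //; exact: measurable_funM.
- by apply: measurable_funD; exact: measurable_funM.
- by apply: (measurable_fun_cvg mF) => w _; exact: FG.
Qed.

Lemma linform_measurable U s : (forall i, measurable_fun [set: Omega] (U i)) ->
  measurable_fun [set: Omega] (fun w => linform s (U^~ w)).
Proof.
move=> mU; elim: s => [|p s ih].
  by under eq_fun do rewrite /linform big_nil; exact: measurable_cst.
under eq_fun do rewrite /linform big_cons.
by apply: measurable_funD => //; exact: measurable_funM.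
Qed.

Lemma trig_integrable U F : (forall i, measurable_fun [set: Omega] (U i)) ->
  trig F -> P.-integrable setT (fun w => (F (U^~ w))%:E).
Proof.
move=> mU tF; have [B FB] := trig_bounded tF.
apply: measurable_bounded_integrable => //.
- by rewrite (le_lt_trans (probability_le1 _ _))// ltry.
- exact: trig_measurable.
- exists B; split; first exact: num_real.
  by move=> x Bx w _ /=; rewrite (le_trans (FB _))// ltW.
Qed.

Section two_families.
Variables U V : I -> Omega -> R.
Hypotheses (mU : forall i, measurable_fun [set: Omega] (U i))
  (mV : forall i, measurable_fun [set: Omega] (V i)).
Hypothesis UV : forall s (A : set R), measurable A ->
  P ((fun w => linform s (U^~ w)) @^-1` A) =
  P ((fun w => linform s (V^~ w)) @^-1` A).

(** Induction on the class: a cosine is a function of one linear form, combinations follow from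
    linearity, limits from dominated convergence with the constant [B]. *)
Lemma trig_same_integral F : trig F ->
  (\int[P]_w (F (U^~ w))%:E = \int[P]_w (F (V^~ w))%:E)%E.
Proof.
elim=> [s c|{}F G a b tF ihF tG ihG|{}F G B tF ihF FB FG].
- have mcos : measurable_fun [set: R] (fun y : R => (cos (y + c))%:E).
    apply/measurable_EFinP; apply: measurableT_comp.
      exact: measurable_cos.
    exact: measurable_funD.
  exact: (same_law_integral (linform_measurable s mU) (linform_measurable s mV)
    (UV s) mcos).
- have lin W : (forall i, measurable_fun [set: Omega] (W i)) ->
      (\int[P]_w (a * F (W^~ w) + b * G (W^~ w))%:E =
       a%:E * \int[P]_w (F (W^~ w))%:E + b%:E * \int[P]_w (G (W^~ w))%:E)%E.
    move=> mW; have iF := trig_integrable mW tF.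
    have iG := trig_integrable mW tG.
    under eq_integral do rewrite EFinD !EFinM.
    rewrite integralD//; [|exact: integrableZl..].
    by rewrite !integralZl.
  by rewrite !lin// ihF ihG.
- have cvgI W : (forall i, measurable_fun [set: Omega] (W i)) ->
      (\int[P]_w (F k (W^~ w))%:E @[k --> \oo] --> \int[P]_w (G (W^~ w))%:E)%E.
    move=> mW.
    have mF k : measurable_fun [set: Omega] (fun w => (F k (W^~ w))%:E).
      by apply/measurable_EFinP; exact: trig_measurable.
    apply: (@dominated_cvg _ _ _ P setT _ _ _ (cst B%:E)) => //.
    + by move=> w _; apply: cvg_EFin; [exact: nearW|exact: FG].
    + exact: finite_measure_integrable_cst.
    + by move=> k w _; rewrite lee_fin.
  have := cvgI V mV; under eq_fun do rewrite -ihF.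
  by move/(cvg_unique _ (cvgI U mU)); apply.
Qed.

Lemma law_forall_le (i : nat -> I) (b : nat -> R) :
  P [set w | forall k, U (i k) w <= b k] = P [set w | forall k, V (i k) w <= b k].
Proof.
have meas (W : I -> Omega -> R) : (forall i, measurable_fun [set: Omega] (W i)) ->
    measurable [set w | forall k, W (i k) w <= b k].
  move=> mW; have -> : [set w | forall k, W (i k) w <= b k] =
      \bigcap_k (W (i k) @^-1` `]-oo, b k]).
    apply/seteqP; split => w /= Wb; first by move=> k _ /=; rewrite in_itv/=.
    by move=> k; have := Wb k Logic.I; rewrite /= in_itv.
  by apply: bigcapT_measurable => k; rewrite -[_ @^-1` _]setTI; exact: mW.
have := trig_same_integral (trig_forall_le i b).
have ind (W : I -> Omega -> R) : (fun w => (\1_[set x : I -> R | forall k, x (i k) <= b k] (W^~ w))%:E)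
    = (fun w => (\1_[set w | forall k, W (i k) w <= b k] w)%:E) :> (Omega -> \bar R).
  by apply/funext => w; rewrite !indicE; congr (_%:R%:E); apply/idP/idP; rewrite !inE.
by rewrite !ind !integral_indic ?setIT//; exact: meas.
Qed.

End two_families.
End law_from_linear_forms.

Section gaussian_families.
Context d (Omega : measurableType d) (R : realType) (P : probability Omega R).
Context {I : Type}.
Implicit Types U V : I -> Omega -> R.

(** Joint normality through all linear forms; these are lists, so that a linear image of a family is
    handled by mapping or flattening the lists. *)
Definition centered_gaussian_family U :=
  [/\ forall i, measurable_fun [set: Omega] (U i),
      forall s, gaussian_rv P (fun w => linform s (U^~ w)) &
      forall i, (\int[P]_w (U i w)%:E = 0)%E].

Lemma linform1 (a : R) (i : I) x : linform [:: (a, i)] x = a * x i.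
Proof. by rewrite /linform big_seq1. Qed.

Lemma gaussian_family_member U i : centered_gaussian_family U ->
  gaussian_rv P (U i).
Proof.
move=> [_ gU _]; have := gU [:: (1, i)].
by under eq_fun do rewrite linform1 mul1r.
Qed.

Lemma gaussian_family_integrableM U i j : centered_gaussian_family U ->
  P.-integrable setT (fun w => (U i w * U j w)%:E).
Proof.
move=> gfU; have [mU gU U0] := gfU.
have m2 k : (\int[P]_w (`|U k w| ^+ 2)%:E < +oo)%E.
  by apply: gaussian_rv_moment_lty => //; exact: gaussian_family_member.
have mX k : measurable_fun [set: Omega] (fun w => (`|U k w| ^+ 2)%:E).
  by apply/measurable_EFinP; apply: measurable_funX; exact: measurableT_comp.
apply/integrableP; split.
  by apply/measurable_EFinP; exact: measurable_funM.
apply: (@le_lt_trans _ _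
    (\int[P]_w ((`|U i w| ^+ 2)%:E + (`|U j w| ^+ 2)%:E))%E).
  apply: le_lower_integral => // w _; rewrite -EFinD lee_fin normrM.
  have := normr_ge0 (U i w); have := normr_ge0 (U j w); nra.
by rewrite ge0_integralD// lte_add_pinfty.
Qed.

Lemma gaussian_family_integrable U i : centered_gaussian_family U ->
  P.-integrable setT (fun w => (U i w)%:E).
Proof.
move=> gfU; have [mU gU U0] := gfU.
apply/integrableP; split; first exact/measurable_EFinP.
have := gaussian_rv_moment_lty 1 (mU i) (gaussian_family_member i gfU) (U0 i).
by under eq_integral do rewrite expr1.
Qed.

Lemma linform_integrable U s : centered_gaussian_family U ->
  P.-integrable setT (fun w => (linform s (U^~ w))%:E).
Proof.
move=> gfU; elim: s => [|p s ih].
  by under eq_fun do rewrite /linform big_nil; exact: finite_measure_integrable_cst.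
under eq_fun do rewrite /linform big_cons EFinD EFinM.
apply: integrableD => //; apply: integrableZl => //.
exact: gaussian_family_integrable.
Qed.

Lemma linform_integral U s : centered_gaussian_family U ->
  (\int[P]_w (linform s (U^~ w))%:E = 0)%E.
Proof.
move=> gfU; have [_ _ U0] := gfU; elim: s => [|p s ih].
  by under eq_integral do rewrite /linform big_nil; rewrite integral0.
under eq_integral do rewrite /linform big_cons EFinD EFinM.
rewrite integralD//; last 2 first.
- by apply: integrableZl => //; exact: gaussian_family_integrable.
- exact: linform_integrable.
by rewrite ih integralZl ?U0 ?mule0 ?adde0//; exact: gaussian_family_integrable.
Qed.

Let linform_mul_integrable1 U i t : centered_gaussian_family U ->
  P.-integrable setT (fun w => (U i w * linform t (U^~ w))%:E).
Proof.
move=> gfU; elim: t => [|p s ih].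
  under eq_fun do rewrite /linform big_nil mulr0.
  exact: finite_measure_integrable_cst.
under eq_fun do rewrite /linform big_cons mulrDr EFinD mulrCA EFinM.
apply: integrableD => //; apply: integrableZl => //.
exact: gaussian_family_integrableM.
Qed.

Lemma linform_mul_integrable U s t : centered_gaussian_family U ->
  P.-integrable setT (fun w => (linform s (U^~ w) * linform t (U^~ w))%:E).
Proof.
move=> gfU; elim: s => [|p s ih].
  under eq_fun do rewrite /linform big_nil mul0r.
  exact: finite_measure_integrable_cst.
under eq_fun do rewrite {1}/linform big_cons mulrDl EFinD -mulrA EFinM.
apply: integrableD => //; apply: integrableZl => //.
exact: linform_mul_integrable1.
Qed.

Lemma linform_mul_integral U (m : I -> I -> R) s t :
  centered_gaussian_family U ->
  (forall i j, (\int[P]_w (U i w * U j w)%:E = (m i j)%:E)%E) ->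
  (\int[P]_w (linform s (U^~ w) * linform t (U^~ w))%:E =
   (\sum_(p <- s) \sum_(q <- t) p.1 * (q.1 * m p.2 q.2))%:E)%E.
Proof.
move=> gfU mU.
have int1 i : (\int[P]_w (U i w * linform t (U^~ w))%:E =
    (\sum_(q <- t) q.1 * m i q.2)%:E)%E.
  elim: t => [|q t ih].
    by under eq_integral do rewrite /linform big_nil mulr0; rewrite integral0 big_nil.
  under eq_integral do rewrite /linform big_cons mulrDr EFinD mulrCA EFinM.
  rewrite integralD//; last 2 first.
  - by apply: integrableZl => //; exact: gaussian_family_integrableM.
  - exact: linform_mul_integrable1.
  rewrite ih integralZl//; last exact: gaussian_family_integrableM.
  by rewrite mU big_cons EFinD EFinM.
elim: s => [|p s ih].
  by under eq_integral do rewrite /linform big_nil mul0r; rewrite integral0 big_nil.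
under eq_integral do rewrite {1}/linform big_cons mulrDl EFinD -mulrA EFinM.
rewrite integralD//; last 2 first.
- by apply: integrableZl => //; exact: linform_mul_integrable1.
- exact: linform_mul_integrable.
rewrite ih integralZl//; last exact: linform_mul_integrable1.
by rewrite int1 big_cons EFinD -EFinM mulr_sumr.
Qed.

(** Equal covariances give each linear form the same variance under both families, hence the same
    centred Gaussian law. *)
Lemma gaussian_family_forall_le U V (i : nat -> I) (b : nat -> R) :
  centered_gaussian_family U -> centered_gaussian_family V ->
  (forall i j, (\int[P]_w (U i w * U j w)%:E = \int[P]_w (V i w * V j w)%:E)%E) ->
  P [set w | forall k, U (i k) w <= b k] = P [set w | forall k, V (i k) w <= b k].
Proof.
move=> gU gV UV; have [mU gsU _] := gU; have [mV gsV _] := gV.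
apply: law_forall_le => // s A mA.
pose m i j := fine (\int[P]_w (U i w * U j w)%:E)%E.
have Um i' j' : (\int[P]_w (U i' w * U j' w)%:E = (m i' j')%:E)%E.
  rewrite fineK//; apply: integrable_fin_num => //.
  exact: gaussian_family_integrableM.
have Vm i' j' : (\int[P]_w (V i' w * V j' w)%:E = (m i' j')%:E)%E by rewrite -UV.
apply: gaussian_rv_law => //; try exact: linform_measurable; try exact: linform_integral.
under eq_integral do rewrite expr2.
under [RHS]eq_integral do rewrite expr2.
by rewrite (linform_mul_integral _ _ gU Um) (linform_mul_integral _ _ gV Vm).
Qed.

End gaussian_families.

(** * Moments, suprema and growth of fractional Brownian motion *)

Section fbm_moments.
Context d (Omega : measurableType d) (R : realType) (P : probability Omega R).
Variables (H : R) (H_range : 2^-1 <= H < 1).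
Variables (W : R -> {RV P >-> R}) (W_fbm : fractional_brownian_motion H W).

(* Times are taken in absolute value to get a family indexed by all of R. *)
Definition abs_time (t : R) (w : Omega) : R := W `|t| w.

Definition fbm_cov (s t : R) : R :=
  2^-1 * (`|t| `^ (2 * H) + `|s| `^ (2 * H) - `| `|t| - `|s| | `^ (2 * H)).

Lemma fbm_family : centered_gaussian_family P abs_time.
Proof.
have [gW _ _ EW _] := W_fbm; split.
- by move=> t; exact: measurable_funP.
- move=> s; have := gW (size s) (fun i => `|(tnth (in_tuple s) i).2|)
    (fun i => (tnth (in_tuple s) i).1) (fun i => normr_ge0 _).
  by under [in X in _ -> X]eq_fun do rewrite /linform big_tnth.
- by move=> t; have := EW `|t| (normr_ge0 t); rewrite unlock.
Qed.

Lemma fbm_covE s t :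
  (\int[P]_w (abs_time s w * abs_time t w)%:E = (fbm_cov s t)%:E)%E.
Proof.
have [_ _ _ EW cW] := W_fbm.
rewrite /fbm_cov -cW// covariance.unlock !EW//= expectation.unlock.
by apply: eq_integral => w _ /=; rewrite !fctE/= !subr0.
Qed.

Lemma fbm_increment s t : 0 <= s -> 0 <= t ->
  (\int[P]_w ((W t w - W s w) ^+ 2)%:E = (`|t - s| `^ (2 * H))%:E)%E.
Proof.
move=> s0 t0; have := linform_mul_integral [:: (1, t); (-1, s)] [:: (1, t); (-1, s)]
  fbm_family fbm_covE.
under eq_integral do
  rewrite -expr2 /linform !big_cons !big_nil/= /abs_time (ger0_norm s0) (ger0_norm t0) mul1r mulN1r addr0.
move=> ->; congr EFin; rewrite !big_cons !big_nil/= /fbm_cov !(ger0_norm s0) !(ger0_norm t0).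
rewrite !subrr normr0 powR0 ?(distrC s t); last by case/andP: H_range; lra.
by field.
Qed.

Lemma powR2E (a : R) : 0 <= a -> a `^ (2 * H) = (a `^ H) ^+ 2.
Proof. by move=> a0; rewrite mulrC powRrM powR_mulrn// powR_ge0. Qed.

Lemma fbm_increment_gaussian s t : 0 <= s -> 0 <= t ->
  gaussian_rv P (fun w => W t w - W s w) /\
  (\int[P]_w (W t w - W s w)%:E = 0)%E.
Proof.
move=> s0 t0.
have e w : linform [:: (1, t); (-1, s)] (abs_time^~ w) = W t w - W s w.
  by rewrite /linform !big_cons !big_nil/= /abs_time (ger0_norm s0) (ger0_norm t0) mul1r mulN1r addr0.
split; first by have [_ + _] := fbm_family => /(_ [:: (1, t); (-1, s)]);
  under eq_fun do rewrite e.
have := linform_integral [:: (1, t); (-1, s)] fbm_family.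
by under eq_integral do rewrite e.
Qed.

Lemma fbm_increment_moment s t p : 0 <= s -> 0 <= t ->
  (\int[P]_w (`|W t w - W s w| ^+ p)%:E =
   (gaussian_ratio R p * (`|t - s| `^ H) ^+ p)%:E)%E.
Proof.
move=> s0 t0; have [g0 m0] := fbm_increment_gaussian s0 t0.
apply: gaussian_rv_moment => //.
- exact: measurable_funB.
- by rewrite fbm_increment// powR2E.
Qed.

Lemma fbm_moment t p : 0 <= t ->
  (\int[P]_w (`|W t w| ^+ p)%:E = (gaussian_ratio R p * (t `^ H) ^+ p)%:E)%E.
Proof.
move=> t0; have [_ W0 _ _ _] := W_fbm.
have := fbm_increment_moment p (lexx 0) t0; rewrite subr0 (ger0_norm t0) => <-.
by under [RHS]eq_integral do rewrite W0 subr0.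
Qed.

End fbm_moments.

(** The even extension of a path or of a cost function is continuous on the whole line, where
    continuity is no longer relative to a subspace. *)
Lemma within_continuous_norm {R : realType} (f : R -> R) :
  {within `[0, +oo[, continuous f} -> continuous (fun t : R => f `|t|).
Proof.
move=> /subspace_continuousP fc x.
have x0 : `[0, +oo[%classic `|x| by rewrite /= in_itv/= andbT.
apply: cvg_trans (fc _ x0) => U /= fU.
have nx : `|y| @[y --> x] --> `|x| by exact: (@norm_continuous R R^o x).
have := nx _ fU; rewrite /= nbhs_simpl/=; apply: filterS => y; apply.
by rewrite /= in_itv/= andbT.
Qed.

Section dyadic_chaining.
Context {R : realType}.
Variables (g : R -> R) (T : R) (lam : nat -> R).
Hypotheses (g0 : g 0 = 0) (T0 : 0 < T) (lam0 : forall j, 0 < lam j).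
Hypothesis g_cont : continuous g.

Definition dyadic_point (n k : nat) : R := T * (k%:R / 2 ^+ n).

(* Bounds every increment of level [n], as |d| <= lam + d ^ 4 / lam ^ 3; only
   integer moments of the increments are then needed. *)
Definition dyadic_osc (n : nat) : R := lam n +
  (\sum_(k < 2 ^ n) `|g (dyadic_point n k.+1) - g (dyadic_point n k)| ^+ 4) /
  lam n ^+ 3.

Lemma dyadic_osc_ge0 n : 0 <= dyadic_osc n.
Proof.
apply: addr_ge0; first exact: ltW.
apply: divr_ge0; last by rewrite exprn_ge0// ltW.
by apply: sumr_ge0 => k _; rewrite exprn_ge0.
Qed.

Lemma dyadic_increment_le n k : (k < 2 ^ n)%N ->
  `|g (dyadic_point n k.+1) - g (dyadic_point n k)| <= dyadic_osc n.
Proof.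
move=> kn; set a := `|_|; have a0 : 0 <= a by exact: normr_ge0.
apply: (@le_trans _ _ (lam n + a ^+ 4 / lam n ^+ 3)); last first.
  rewrite lerD2l; apply: ler_wpM2r; first by rewrite invr_ge0 exprn_ge0// ltW.
  rewrite (bigD1 (Ordinal kn))//= lerDl.
  by apply: sumr_ge0 => i _; rewrite exprn_ge0.
have [al|la] := leP a (lam n).
  by rewrite (le_trans al)// lerDl divr_ge0// exprn_ge0// ltW.
apply: ler_wpDl; first exact: ltW.
rewrite ler_pdivlMr ?exprn_gt0// [leRHS]exprS ler_wpM2l//.
by apply: lerXn2r; rewrite ?nnegrE// ltW.
Qed.

(** An even point of level n + 1 is a point of level n; an odd one is a single increment away from
    the even point before it. *)
Lemma dyadic_grid_le n k : (k <= 2 ^ n)%N ->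
  `|g (dyadic_point n k)| <= \sum_(j < n.+1) dyadic_osc j.
Proof.
elim: n k => [|n ih] k.
  rewrite expn0 big_ord1; case: k => [_|[_|//]].
    by rewrite /dyadic_point mul0r mulr0 g0 normr0 dyadic_osc_ge0.
  have := @dyadic_increment_le 0 0 isT.
  by rewrite /dyadic_point mul0r mulr0 g0 subr0.
move=> kn; rewrite big_ord_recr/=.
have half i : dyadic_point n.+1 i.*2 = dyadic_point n i.
  rewrite /dyadic_point -mul2n natrM exprS; congr (_ * _).
  by field; rewrite expf_neq0.
rewrite -(odd_double_half k); case: (boolP (odd k)) => ko /=.
  have k2 : (k./2 < 2 ^ n)%N.
    by move: kn; rewrite expnS mul2n -{1}(odd_double_half k) ko add1n ltn_double.
  have := @dyadic_increment_le n.+1 k./2.*2.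
  rewrite expnS mul2n ltn_double k2 => /(_ isT) inc.
  rewrite add1n -[g _](subrK (g (dyadic_point n.+1 k./2.*2))) addrC.
  rewrite (le_trans (ler_normD _ _))// lerD// half.
  by apply: ih; exact: ltnW.
have k2 : (k./2 <= 2 ^ n)%N.
  rewrite -leq_double -(mul2n (2 ^ n)) -expnS (leq_trans _ kn)//.
  by rewrite -[leqRHS]odd_double_half leq_addl.
by rewrite add0n half (le_trans (ih _ k2))// lerDl dyadic_osc_ge0.
Qed.

(** [t] is the limit of its dyadic approximations from below, and the values of [g] there are
    bounded by partial sums of the series. *)
Lemma dyadic_chaining t : 0 <= t <= T ->
  (`|g t|%:E <= \sum_(0 <= j <oo) (dyadic_osc j)%:E)%E.
Proof.
move=> /andP[t0 tT].
pose k n := Num.truncn (2 ^+ n * (t / T)).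
pose s n := dyadic_point n (k n).
have tT1 : 0 <= t / T <= 1.
  by apply/andP; split; [rewrite divr_ge0// ltW|rewrite ler_pdivrMr// mul1r].
have kn n : (k n <= 2 ^ n)%N.
  have : (k n)%:R <= 2 ^+ n * (t / T).
    by rewrite truncn_le mulr_ge0// ?exprn_ge0; lra.
  move=> kle; rewrite -(ler_nat R) natrX (le_trans kle)// ler_piMr ?exprn_ge0//.
  by case/andP: tT1.
have st : s n @[n --> \oo] --> t.
  apply/cvgrPdist_lt => e e0.
  have eT0 : 0 < e / T by rewrite divr_gt0.
  have := near_infty_natSinv_expn_lt (PosNum eT0); apply: filterS => n /= ne.
  have n20 : 0 < 2 ^+ n :> R by rewrite exprn_gt0.
  have /andP[k1 k2] : (k n)%:R <= 2 ^+ n * (t / T) < (k n).+1%:R.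
    by apply: truncn_itv; apply: mulr_ge0; [exact: ltW|case/andP: tT1].
  have -> : t - s n = T * ((2 ^+ n * (t / T) - (k n)%:R) / 2 ^+ n).
    by rewrite /s /dyadic_point; field; rewrite !gt_eqF.
  rewrite ger0_norm; last first.
    apply: mulr_ge0; first exact: ltW.
    by apply: divr_ge0; [rewrite subr_ge0|exact: ltW].
  rewrite -ltr_pdivlMl// (mulrC T^-1); apply: le_lt_trans ne.
  rewrite ler_pM2r ?invr_gt0// lerBlDr -natr1 in k2 *; lra.
have gst : `|g (s n)|%:E @[n --> \oo] --> `|g t|%:E.
  apply: cvg_EFin; first exact: nearW.
  by apply: cvg_norm; apply: continuous_cvg st; exact: g_cont.
apply: (cvge_to_le gst); apply: nearW => n.
apply: (@le_trans _ _ (\sum_(0 <= j < n.+1) (dyadic_osc j)%:E)%E).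
  by rewrite big_mkord sumEFin lee_fin; exact: dyadic_grid_le.
by apply: nneseries_lim_ge => j _ _; rewrite lee_fin dyadic_osc_ge0.
Qed.

End dyadic_chaining.

Lemma geometric_sum_le {R : realType} (x : R) n : 0 <= x < 1 ->
  \sum_(0 <= j < n) x ^+ j <= (1 - x)^-1.
Proof.
move=> /andP[x0 x1]; have x1' : 0 < 1 - x by rewrite subr_gt0.
have e : (1 - x) * \sum_(0 <= j < n) x ^+ j = 1 - x ^+ n.
  elim: n => [|n ih]; first by rewrite big_nil mulr0 expr0 subrr.
  by rewrite big_nat_recr//= mulrDr ih exprS; ring.
by rewrite -(ler_pM2l x1') e mulfV ?gt_eqF// lerBlDr lerDl exprn_ge0.
Qed.

Lemma nneseries_geometric_le {R : realType} (a : nat -> \bar R) (c x : R) :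
  0 <= c -> 0 <= x < 1 -> (forall j, (0 <= a j)%E) ->
  (forall j, (a j <= (c * x ^+ j)%:E)%E) ->
  (\sum_(0 <= j <oo) a j <= (c / (1 - x))%:E)%E.
Proof.
move=> c0 x01 a0 ax; apply: lime_le; first by apply: is_cvg_nneseries.
apply: nearW => n.
apply: (@le_trans _ _ (\sum_(0 <= j < n) (c * x ^+ j)%:E)%E).
  by apply: lee_sum => j _; exact: ax.
by rewrite sumEFin lee_fin -mulr_sumr ler_wpM2l// geometric_sum_le.
Qed.

Section fbm_supremum.
Context d (Omega : measurableType d) (R : realType) (P : probability Omega R).
Variables (H : R) (H_range : 2^-1 <= H < 1).
Variables (W : R -> {RV P >-> R}) (W_fbm : fractional_brownian_motion H W).

Lemma abs_time_continuous w : continuous (abs_time W ^~ w).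
Proof. by have [_ _ cW _ _] := W_fbm; exact: within_continuous_norm (cW w). Qed.

Lemma abs_time0 w : abs_time W 0 w = 0.
Proof. by have [_ W0 _ _ _] := W_fbm; rewrite /abs_time normr0 W0. Qed.

(* There are 2 ^ j increments of level j, of fourth moment at most a multiple
   of (2 ^ j) ^ - 2 as H >= 1/2; dividing by lam ^ 3 leaves the ratio
   rho = 1 / (2 q ^ 3) < 1. *)
Let q : R := 5 / 6.
Let rho : R := 108 / 125.

Let lam (T : R) (j : nat) := T `^ H * q ^+ j.

Let lam_gt0 T j : 0 < T -> 0 < lam T j.
Proof. by move=> T0; rewrite mulr_gt0 ?powR_gt0// exprn_gt0// /q; lra. Qed.

Let osc (T : R) j w := dyadic_osc (abs_time W ^~ w) T (lam T) j.

Let mosc T j : measurable_fun [set: Omega] (osc T j).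
Proof.
have mW t : measurable_fun [set: Omega] (abs_time W t) by exact: measurable_funP.
apply: measurable_funD => //; apply: measurable_funM => //.
apply: measurable_sum => k; apply: measurable_funX.
by apply: measurableT_comp => //; exact: measurable_funB.
Qed.

Let int_osc T j : 0 < T ->
  (\int[P]_w (osc T j w)%:E <=
   (T `^ H * (q ^+ j + gaussian_ratio R 4 * rho ^+ j))%:E)%E.
Proof.
move=> T0; have L0 := lam_gt0 j T0; have r0 := gaussian_ratio_ge0 R 4.
have mW t : measurable_fun [set: Omega] (abs_time W t) by exact: measurable_funP.
have mX k : measurable_fun [set: Omega] (fun w => (`|abs_time W (dyadic_point T j k.+1) w -
      abs_time W (dyadic_point T j k) w| ^+ 4)%:E).
  apply/measurable_EFinP; apply: measurable_funX.
  by apply: measurableT_comp => //; exact: measurable_funB.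
have pt0 k : 0 <= dyadic_point T j k.
  by apply: mulr_ge0; [exact: ltW|rewrite divr_ge0// exprn_ge0].
pose a : R := T `^ H; have a0 : 0 < a by rewrite powR_gt0.
pose h : R := ((2 ^+ j)^-1) `^ H.
have h0 : 0 <= h by exact: powR_ge0.
(* Here [H >= 1/2] enters: as 2^-j <= 1, its power H is at most its square root. *)
have h2 : h ^+ 2 <= (2 ^+ j)^-1.
  have j20 : 0 <= (2 ^+ j)^-1 :> R by rewrite invr_ge0 exprn_ge0.
  rewrite -[leRHS](sqr_sqrtr j20) lerXn2r ?nnegrE ?sqrtr_ge0// -powR12_sqrt//.
  apply: ger_powR; last by case/andP: H_range.
  by rewrite invr_gt0 exprn_gt0//= invf_le1 ?exprn_gt0// exprn_ege1 ?ler1n.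
have oscE w : ((osc T j w)%:E = (lam T j)%:E + (\sum_(k < 2 ^ j)
    (`|abs_time W (dyadic_point T j k.+1) w -
      abs_time W (dyadic_point T j k) w| ^+ 4)%:E) * (lam T j ^+ 3)^-1%:E)%E.
  by rewrite sumEFin -EFinM -EFinD.
under eq_integral do rewrite oscE.
rewrite ge0_integralD//; last 3 first.
- by move=> w _; rewrite lee_fin ltW.
- move=> w _; rewrite mule_ge0//; last by rewrite lee_fin invr_ge0 exprn_ge0// ltW.
  by apply: sume_ge0 => k _; rewrite lee_fin exprn_ge0.
- by apply: emeasurable_funM => //; exact: emeasurable_sum.
rewrite probability_integral_cst ge0_integralZr//; last 3 first.
- exact: emeasurable_sum.
- by move=> w _; apply: sume_ge0 => k _; rewrite lee_fin exprn_ge0.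
- by rewrite lee_fin invr_ge0 exprn_ge0// ltW.
rewrite ge0_integral_sum//.
have inc k : (\int[P]_w (`|abs_time W (dyadic_point T j k.+1) w -
      abs_time W (dyadic_point T j k) w| ^+ 4)%:E =
    (gaussian_ratio R 4 * (a * h) ^+ 4)%:E)%E.
  rewrite /abs_time !(ger0_norm (pt0 _)) (fbm_increment_moment H_range W_fbm)//.
  congr (_ * _ ^+ 4)%:E; rewrite /dyadic_point -mulrBr -mulrBl -natr1 addrAC subrr add0r.
  by rewrite mul1r ger0_norm ?mulr_ge0 ?invr_ge0 ?exprn_ge0 ?ltW// powRM ?invr_ge0 ?exprn_ge0 ?ltW.
under eq_bigr do rewrite inc.
rewrite sumEFin sumr_const card_ord -EFinM -EFinD lee_fin mulrDr lerD//.
rewrite -mulr_natl natrX ler_pdivrMr ?exprn_gt0// /lam -/a.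
have q30 : 0 < q ^+ j by rewrite exprn_gt0// /q; lra.
have -> : rho ^+ j = (2 ^+ j)^-1 / (q ^+ j) ^+ 3.
  have -> : rho = 2^-1 / q ^+ 3 by rewrite /rho /q; field.
  by rewrite expr_div_n exprVn -!exprM mulnC.
have z0 : 0 < 2 ^+ j :> R by rewrite exprn_gt0.
move: (q ^+ j) (2 ^+ j) q30 z0 h2 => y z y0 z0 h2.
rewrite [leLHS](_ : _ = gaussian_ratio R 4 * a ^+ 4 * z * (h ^+ 2) ^+ 2); last by ring.
rewrite [leRHS](_ : _ = gaussian_ratio R 4 * a ^+ 4 * z * z^-1 ^+ 2); last first.
  by field; rewrite !gt_eqF.
apply: ler_wpM2l.
  apply: mulr_ge0; last exact: ltW.
  by apply: mulr_ge0 => //; rewrite exprn_ge0// ltW.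
by rewrite lerXn2r ?nnegrE ?exprn_ge0// invr_ge0 ltW.
Qed.

(** [B] is the chaining series itself, measurable by construction. Its mean is dominated by a
    geometric series of ratio [rho], since [q <= rho]. *)
Lemma fbm_sup_bound : exists2 k : R, 0 <= k & forall T, 0 < T ->
  exists B : Omega -> \bar R, [/\ measurable_fun [set: Omega] B,
    forall w, (0 <= B w)%E,
    forall w t, 0 <= t <= T -> (`|W t w|%:E <= B w)%E &
    (\int[P]_w B w <= (k * T `^ H)%:E)%E].
Proof.
have r0 := gaussian_ratio_ge0 R 4.
exists ((1 + gaussian_ratio R 4) / (1 - rho)) => [|T T0].
  by apply: divr_ge0; [exact: addr_ge0|rewrite /rho; lra].
exists (fun w => \sum_(0 <= j <oo) (osc T j w)%:E)%E.
have osc0 j w : (0 <= (osc T j w)%:E)%E.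
  by rewrite lee_fin dyadic_osc_ge0// => i; exact: lam_gt0.
have mo j : measurable_fun [set: Omega] (fun w => (osc T j w)%:E).
  by apply/measurable_EFinP; exact: mosc.
split.
- exact: ge0_emeasurable_sum.
- by move=> w; exact: nneseries_ge0.
- move=> w t tT; have /andP[t0 _] := tT.
  have -> : W t w = abs_time W t w by rewrite /abs_time ger0_norm.
  apply: (@dyadic_chaining R (abs_time W ^~ w) T (lam T)) => //.
  + exact: abs_time0.
  + by move=> i; exact: lam_gt0.
  + exact: abs_time_continuous.
- rewrite integral_nneseries// mulrAC.
  apply: nneseries_geometric_le.
  + by rewrite mulr_ge0 ?addr_ge0 ?powR_ge0.
  + by rewrite /rho; lra.
  + by move=> j; exact: integral_ge0.
  + move=> j; apply: (le_trans (int_osc j T0)); rewrite lee_fin.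
    have qr : q ^+ j <= rho ^+ j.
      by rewrite lerXn2r ?nnegrE// /q /rho; lra.
    have a0 : 0 <= T `^ H by exact: powR_ge0.
    rewrite [leRHS](_ : _ = T `^ H * (rho ^+ j + gaussian_ratio R 4 * rho ^+ j));
      last by ring.
    by rewrite ler_wpM2l// lerD2r.
Qed.

End fbm_supremum.

Section fbm_growth.
Context d (Omega : measurableType d) (R : realType) (P : probability Omega R).
Variables (H : R) (H_range : 2^-1 <= H < 1).
Variables (W : R -> {RV P >-> R}) (W_fbm : fractional_brownian_motion H W).

(* The bounds on [0, 2 ^ n] divided by 2 ^ n have summable means, of order
   2 ^ (n (H - 1)); hence they tend to 0 almost surely. *)
Lemma fbm_ae_drift_bounded : {ae P, forall w, forall v, 0 < v ->
  exists M, forall s, 0 <= s -> W s w - v * s <= M}.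
Proof.
have [k k0 supB] := fbm_sup_bound H_range W_fbm.
have T0 n : 0 < 2 ^+ n :> R by rewrite exprn_gt0.
pose B n := sval (cid (supB _ (T0 n))).
have [mB B0 WB iB] : [/\ forall n, measurable_fun [set: Omega] (B n),
    forall n w, (0 <= B n w)%E,
    forall n w t, 0 <= t <= 2 ^+ n -> (`|W t w|%:E <= B n w)%E &
    forall n, (\int[P]_w B n w <= (k * (2 ^+ n) `^ H)%:E)%E].
  by split=> n; rewrite /B; case: cid => ? [].
pose a n w := (B n w * ((2 ^+ n)^-1)%:E)%E.
have i20 n : 0 <= (2 ^+ n)^-1 :> R by rewrite invr_ge0 ltW.
have a0 n w : (0 <= a n w)%E by rewrite mule_ge0// lee_fin.
have ma n : measurable_fun [set: Omega] (a n) by exact: emeasurable_funM.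
pose S w := (\sum_(0 <= n <oo) a n w)%E.
have mS : measurable_fun [set: Omega] S by exact: ge0_emeasurable_sum.
have S0 w : (0 <= S w)%E by exact: nneseries_ge0.
pose x : R := 2 `^ (H - 1).
have x01 : 0 <= x < 1.
  rewrite powR_ge0/= -(powRr0 2) /x /powR pnatr_eq0/= ltr_expR ltr_pM2r ?ln_gt0 ?ltr1n//.
  by rewrite subr_lt0; case/andP: H_range.
have iS : (\int[P]_w S w <= (k / (1 - x))%:E)%E.
  rewrite integral_nneseries//; apply: nneseries_geometric_le => // j.
    exact: integral_ge0.
  rewrite ge0_integralZr// ?lee_fin//.
  apply: (@le_trans _ _ ((k * (2 ^+ j) `^ H)%:E * ((2 ^+ j)^-1)%:E)%E).
    by rewrite lee_wpmul2r ?lee_fin.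
  rewrite -EFinM lee_fin -mulrA ler_wpM2l// /x -powR_mulrn// -powRN.
  rewrite -powRrM -powRD; last by rewrite pnatr_eq0 implybT.
  by rewrite -powR_mulrn ?powR_ge0// -powRrM le_eqVlt; apply/orP; left; apply/eqP; congr (_ `^ _); ring.
have Sint : P.-integrable setT S.
  apply/integrableP; split => //.
  under eq_integral do rewrite gee0_abs//.
  by rewrite (le_lt_trans iS)// ltry.
have := integrable_ae measurableT Sint; apply: filterS => w /(_ I) Sfin v v0.
have Sw : (S w < +oo)%E by rewrite ltey_eq Sfin.
have /fine_cvgP := nneseries_tail_cvg Sw (fun n _ => a0 n w).
move=> [tfin /cvgrPdist_lt] => /(_ (v / 2)); rewrite divr_gt0// => /(_ isT).
move=> tv; have [N _ aN] : \forall n \near \oo, (a n w <= (v / 2)%:E)%E.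
  near=> n.
  have tf : (\sum_(n <= i <oo) a i w)%E \is a fin_num by near: n.
  have : `|0 - fine (\sum_(n <= i <oo) a i w)%E| < v / 2 by near: n.
  rewrite sub0r normrN => tn.
  apply: (@le_trans _ _ (\sum_(n <= i <oo) a i w)%E).
    have := @nneseries_lim_ge R (fun i => a i w) xpredT n n.+1 (fun i _ _ => a0 i w).
    by rewrite big_nat1.
  by rewrite -(fineK tf) lee_fin (le_trans (ler_norm _))// ltW.
have BN n : (N <= n)%N -> (B n w <= (v / 2 * 2 ^+ n)%:E)%E.
  move=> Nn; have := aN n Nn; rewrite /a => an.
  have -> : B n w = (B n w * ((2 ^+ n)^-1)%:E * (2 ^+ n)%:E)%E.
    by rewrite -muleA -EFinM mulVf ?mule1// gt_eqF.
  by rewrite EFinM lee_wpmul2r// lee_fin ltW.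
(* On [0, 2^N] the path stays below this value. If 2^n < s <= 2^(n+1) with n >= N, then W s <= v/2 *
   2^(n+1) = v * 2^n <= v * s; the factor 1/2 pays for the doubling. *)
exists (v / 2 * 2 ^+ N) => s s0.
have ex : exists n, s <= 2 ^+ n.
  exists (Num.bound s); rewrite -natrX.
  have := archi_boundP s0 => /ltW /le_trans; apply.
  by rewrite ler_nat ltnW// ltn_expl.
have [n sn minn] := ex_minnP ex.
have Wle : W s w <= `|W s w| by exact: ler_norm.
have [nN|Nn] := leqP n N.
  have sN : 0 <= s <= 2 ^+ N.
    by rewrite s0 (le_trans sn)// ler_weXn2l// ler1n.
  have := le_trans (WB N w s sN) (BN N (leqnn N)); rewrite lee_fin => ?.
  have : 0 <= v * s by rewrite mulr_ge0// ltW.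
  lra.
case: n sn minn Nn => // n sn minn Nn.
have ns : 2 ^+ n < s by rewrite ltNge; apply/negP => /minn; rewrite ltnn.
have sn' : 0 <= s <= 2 ^+ n.+1 by rewrite s0.
have := le_trans (WB n.+1 w s sn') (BN n.+1 (ltnW Nn)); rewrite lee_fin exprS => ?.
have vs : v * 2 ^+ n <= v * s by rewrite ler_pM2l// ltW.
have : 0 <= v / 2 * 2 ^+ N by rewrite mulr_ge0 ?exprn_ge0// ltW// divr_gt0.
lra.
Unshelve. all: by end_near. Qed.

End fbm_growth.

Lemma measurable_fun_rays d (T : measurableType d) (R : realType) (f : T -> R) :
  (forall z, measurable [set w | f w <= z]) -> measurable_fun [set: T] f.
Proof.
move=> mf; apply: (measurability _ (RGenOInfty.measurableE R)) => _ [_ [z ->] <-].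
rewrite setTI; have -> : f @^-1` `]z, +oo[ = ~` [set w | f w <= z].
  apply/seteqP; split => w /=; rewrite in_itv/= andbT ltNge; first by move/negP.
  by move/negP.
exact: measurableC.
Qed.

(** * The Skorokhod reflection *)

Section dense_times.
Context {R : realType}.
Implicit Types (t r s z : R) (y : R -> R).

(** An enumeration of the rationals by [nat], the index of the constraints in the joint-law lemmas;
    codes of no rational yield 0. *)
Definition rat_time (k : nat) : R := ratr (odflt 0 (unpickle k : option rat)).

(** For [0 <= t], the projection on [[0, t]]: it brings no point further from a point of [[0, t]],
    so clipped rationals are dense there. *)
Definition clip t r : R := Num.max 0 (Num.min r t).

Lemma clip_itv t r : 0 <= t -> 0 <= clip t r <= t.
Proof.
move=> t0; rewrite /clip le_max lexx/=.
by rewrite ge_max t0/= ge_min lexx orbT.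
Qed.

Lemma clip_dist t r s : 0 <= s <= t -> `|clip t r - s| <= `|r - s|.
Proof.
move=> /andP[s0 st]; rewrite /clip.
have [rt|rt] := leP r t.
  have [//|r0] := leP 0 r.
  by rewrite sub0r normrN ger0_norm// ler0_norm; lra.
have [t0|t0] := leP 0 t; last lra.
by rewrite ger0_norm ?subr_ge0// ger0_norm; lra.
Qed.

(** If [y s > z], then [y] exceeds [z] on a neighbourhood of [s], hence at some clipped rational. *)
Lemma dense_times_le y t z : {within `[0, +oo[, continuous y} -> 0 <= t ->
  (forall s, 0 <= s <= t -> y s <= z) <->
  (forall k, y (clip t (rat_time k)) <= z).
Proof.
move=> /within_continuous_norm yc t0; split => [yz k|yz s st].
  by apply: yz; exact: clip_itv.
have /andP[s0 _] := st; rewrite leNgt; apply/negP => zy.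
have zys : z < y `|s| by rewrite ger0_norm.
have := @cvgr_gt _ _ _ _ (fun r => y `|r|) _ (yc s) _ zys.
move=> [e /= e0 se].
have [q] := @rat_in_itvoo R s (s + e) ltac:(lra); rewrite in_itv/= => /andP[sq qe].
have := yz (pickle q); rewrite /rat_time pickleK/=; apply/negP; rewrite -ltNge.
have c0 : 0 <= clip t (ratr q) by have /andP[] := clip_itv (ratr q) t0.
rewrite -[clip _ _]ger0_norm//; apply: se; rewrite /ball/= distrC.
rewrite (le_lt_trans (clip_dist _ st))// gtr0_norm ?subr_gt0//; lra.
Qed.

End dense_times.

Section running_maximum.
Context {R : realType}.
Implicit Types (t r s z : R).
Variable y : R -> R.
Hypothesis y_cont : {within `[0, +oo[, continuous y}.

(** The regulator of a deterministic path. Besides [regulator], it also represents running maxima,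
    see [drift_max]. *)
Definition reg t : R := - Num.min 0 (inf [set y s | s in `[0, t]]).

(** Presents [reg t] as the least upper bound of 0 and the [- y s]; the later facts go through this
    equivalence instead of the infimum. Compactness of [[0, t]] makes the set bounded below. *)
Lemma reg_le t z : 0 <= t ->
  reg t <= z <-> 0 <= z /\ forall s, 0 <= s <= t -> - y s <= z.
Proof.
move=> t0; rewrite /reg; set A := (X in inf X).
have ic : {within `[0, t], continuous y}.
  apply: continuous_subspaceW y_cont => r /=; rewrite !in_itv/= => /andP[-> _]//.
have [c ct yc] := EVT_min t0 ic.
have lA : lbound A (y c).
  by move=> _ [s st <-]; apply: yc.
have infA : has_inf A.
  by split; [exists (y 0), 0 => //=; rewrite in_itv/= lexx|exists (y c)].
rewrite lerNl le_min oppr_le0; split.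
  move=> /andP[z0 zA]; split => // s st; rewrite lerNl (le_trans zA)//.
  by apply: (inf_lbound infA.2); exists s.
move=> [-> zA]/=; apply: lb_le_inf; first exact: infA.1.
by move=> _ [s st <-]; rewrite lerNl; apply: zA; move: st; rewrite /= in_itv.
Qed.

Lemma reg_ge0 t : 0 <= t -> 0 <= reg t.
Proof. by move=> t0; have [] := (reg_le (reg t) t0).1 (lexx _). Qed.

Lemma reg_ge t s : 0 <= s <= t -> - y s <= reg t.
Proof.
move=> /[dup] st /andP[s0 st']; have t0 := le_trans s0 st'.
by have [_] := (reg_le (reg t) t0).1 (lexx _); apply.
Qed.

Lemma reg_nondecreasing s t : 0 <= s -> s <= t -> reg s <= reg t.
Proof.
move=> s0 st; apply/(reg_le _ s0); split; first exact: reg_ge0 (le_trans s0 st).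
by move=> r /andP[r0 rs]; apply: reg_ge; rewrite r0 (le_trans rs).
Qed.

(** For s <= t, nonnegativity at s and monotonicity give - y s <= k s <= k t. *)
Lemma reg_min (k : R -> R) t : 0 <= t ->
  (forall s, 0 <= s -> 0 <= k s) ->
  (forall r s, 0 <= r -> r <= s -> k r <= k s) ->
  (forall s, 0 <= s -> 0 <= y s + k s) -> reg t <= k t.
Proof.
move=> t0 k0 km yk; apply/(reg_le _ t0); split; first exact: k0.
move=> s /andP[s0 st]; rewrite (le_trans _ (km _ _ s0 st))//.
by rewrite -subr_ge0 opprK addrC; exact: yk.
Qed.

Lemma reg_continuous : continuous (fun t : R => reg `|t|).
Proof.
have gc := within_continuous_norm y_cont.
move=> t0; apply/cvgrPdist_le => e e0.
have e20 : 0 < e / 2 by rewrite divr_gt0.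
have /cvgrPdist_le/(_ _ e20)[dl /= dl0 gd] := gc `|t0|.
rewrite normr_id in gd.
(* Between a and b the regulator grows at most by the oscillation of [y] on [a, b], whose points all
   lie within [dl] of |t0|; passing through |t0| costs e/2 twice. *)
have near_le a b : 0 <= a -> a <= b -> `| `|t0| - a| < dl -> `| `|t0| - b| < dl ->
    `|reg a - reg b| <= e.
  move=> a0 ab ta tb; have b0 := le_trans a0 ab.
  rewrite ler0_norm ?subr_le0 ?reg_nondecreasing// opprB lerBlDr.
  apply/(reg_le _ b0); split; first by rewrite addr_ge0 ?reg_ge0// ltW.
  move=> s /andP[s0 sb]; have [sa|as_] := leP s a.
    apply: (@le_trans _ _ (reg a)); first by apply: reg_ge; rewrite s0.
    by rewrite lerDr ltW.
  have := gd a ta; have := gd s; rewrite /ball/= (ger0_norm s0) (ger0_norm a0).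
  have -> : `| `|t0| - s| < dl.
    by move: ta tb; rewrite !ltr_norml => /andP[? ?] /andP[? ?]; apply/andP; split; lra.
  have := @reg_ge a a; rewrite a0 lexx => /(_ isT).
  by move=> ya /(_ isT); rewrite !ler_norml => /andP[? ?] /andP[? ?]; lra.
have nt : `|t| @[t --> t0] --> `|t0| by exact: (@norm_continuous R R^o t0).
have /cvgrPdist_lt/(_ _ dl0) := nt; apply: filterS => t td.
have [le_tt0|lt_t0t] := leP `|t0| `|t|.
  by apply: near_le => //; rewrite subrr normr0.
by rewrite distrC; apply: near_le => //; rewrite ?ltW// subrr normr0.
Qed.

Lemma reg_cadlag : cadlag reg.
Proof.
have rc := reg_continuous.
split=> t t0.
- have rt : reg `|s| @[s --> t^'+] --> reg t.
    by rewrite -{2}(ger0_norm t0); apply: cvg_at_right_filter; exact: rc.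
  apply: cvg_trans rt; apply: near_eq_cvg; near=> s.
  by rewrite ger0_norm// (le_trans t0)// ltW.
- have rt : reg `|s| @[s --> t^'-] --> reg `|t|.
    by apply: cvg_at_left_filter; exact: rc.
  apply/cvg_ex; exists (reg `|t|); apply: cvg_trans rt; apply: near_eq_cvg.
  near=> s; rewrite ger0_norm//; near: s.
  exact: nbhs_left_ge.
Unshelve. all: by end_near. Qed.

End running_maximum.

(** * Upper limits at infinity *)

Section limsup_at_infinity.
Context {R : realType}.
Implicit Types f g : R -> \bar R.
Local Open Scope ereal_scope.

Lemma limsup_pinfty_ub f (A : R) (a : \bar R) :
  (forall t, (A < t)%R -> f t <= a) -> limsup_pinfty f <= a.
Proof.
move=> fa; rewrite /limsup_pinfty limf_esupE.
apply: (@le_trans _ _ (ereal_sup (f @` [set t | (A < t)%R]))).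
  apply: ereal_inf_lbound; exists [set t | (A < t)%R] => //.
  by exists A; split => //; exact: num_real.
by apply: ge_ereal_sup => _ [t At <-]; exact: fa.
Qed.

Lemma limsup_pinfty_lb f (A : R) (a : \bar R) :
  (forall t, (A < t)%R -> a <= f t) -> a <= limsup_pinfty f.
Proof.
move=> fa; rewrite /limsup_pinfty limf_esupE.
apply: le_ereal_inf_tmp => _ /= [V [M [_ MV]] <-].
have MA : (Num.max A M < Num.max A M + 1)%R by rewrite ltrDl.
apply: (@le_trans _ _ (f (Num.max A M + 1)%R)).
  by apply: fa; rewrite (le_lt_trans _ MA)// le_max lexx.
apply: ereal_sup_ubound; exists (Num.max A M + 1)%R => //.
by apply: MV; rewrite (le_lt_trans _ MA)// le_max lexx orbT.
Qed.

Lemma limsup_pinfty_le f g (A : R) :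
  (forall t, (A < t)%R -> f t <= g t) -> limsup_pinfty f <= limsup_pinfty g.
Proof.
move=> fg; rewrite [leRHS]/limsup_pinfty limf_esupE.
apply: le_ereal_inf_tmp => _ /= [V [M [_ MV]] <-].
apply: (@limsup_pinfty_ub _ (Num.max A M)) => t; rewrite gt_max => /andP[At Mt].
by apply: (le_trans (fg t At)); apply: ereal_sup_ubound; exists t => //; exact: MV.
Qed.

End limsup_at_infinity.

Section skorokhod.
Context d (Omega : measurableType d) (R : realType) (P : probability Omega R).
Variables (W : R -> {RV P >-> R}).
Hypothesis W_cont : forall w, {within `[0, +oo[, continuous (fun t => W t w)}.
Hypothesis W0 : forall w, W 0 w = 0.
Variables (sigma : R -> R) (x u : R).

Lemma netput_continuous w :
  {within `[0, +oo[, continuous (fun t => netput W sigma x u t w)}.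
Proof.
have lin : continuous (fun t : R => x - u * t).
  move=> t; apply: cvgB; first exact: cvg_cst.
  by apply: cvgM; [exact: cvg_cst|exact: cvg_id].
move=> t; apply: cvgD; first exact: (continuous_subspaceT lin).
by apply: cvgM; [exact: cvg_cst|exact: W_cont].
Qed.

Lemma regulatorE t w :
  regulator W sigma x u t w = reg (fun s => netput W sigma x u s w) t.
Proof. by []. Qed.

Lemma regulator_le t z w : 0 <= t -> regulator W sigma x u t w <= z <->
  0 <= z /\ forall s, 0 <= s <= t -> - netput W sigma x u s w <= z.
Proof. exact: (@reg_le _ _ (@netput_continuous w)). Qed.

Lemma regulator_le_dense t z w : 0 <= t -> regulator W sigma x u t w <= z <->
  0 <= z /\ forall k, - netput W sigma x u (clip t (rat_time k)) w <= z.
Proof.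
move=> t0; split=> [/(regulator_le _ _ t0)[z0 yz]|[z0 yz]].
  by split => // k; apply: yz; exact: clip_itv.
apply/(regulator_le _ _ t0); split => //.
apply/(@dense_times_le _ (fun s => - netput W sigma x u s w)) => // s.
apply: cvgN.
exact: netput_continuous.
Qed.

(** Each sublevel set is a countable intersection of generators of the filtration at [t], because
    clipped times lie in [[0, t]]. *)
Lemma regulator_adapted :
  adapted (augmented_filtration W) (regulator W sigma x u).
Proof.
move=> t t0; rewrite /augmented_filtration; set G := (G in <<s G >>).
have mL : measurable_fun [set: g_sigma_algebraType G] (regulator W sigma x u t).
  apply: measurable_fun_rays => z.
  have [z0|z0] := leP 0 z; last first.
    rewrite (_ : [set _ | _] = set0); first exact: measurable0.
    apply/seteqP; split => // w /= /(regulator_le _ _ t0)[]; lra.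
  rewrite (_ : [set _ | _] = \bigcap_k
      [set w | - netput W sigma x u (clip t (rat_time k)) w <= z]); last first.
    apply/seteqP; split => w /=.
      by move=> /(regulator_le_dense _ _ t0)[_ h] k _; exact: h.
    by move=> h; apply/(regulator_le_dense _ _ t0); split => // k; exact: h.
  apply: bigcapT_measurable => k; apply: sub_sigma_algebra; left.
  set s := clip t _; exists s; split; first exact: clip_itv.
  exists [set r | - (x - u * s + sigma u * r) <= z] => //.
  rewrite (_ : [set _ | _] = (fun r => - (x - u * s + sigma u * r)) @^-1` `]-oo, z]).
    rewrite -[_ @^-1` _]setTI; apply: measurable_funN => //.
    exact: measurable_affine.
  by apply/seteqP; split => r /=; rewrite in_itv.
move=> B mB; have := mL measurableT B mB; by rewrite setTI.
Qed.

Lemma admissible_reflected : 0 <= x -> admissible W sigma x u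
  (reflected W sigma x u) (regulator W sigma x u).
Proof.
move=> x0; split => //.
- move=> w; have yc := @netput_continuous w; split.
  + by move=> t t0; exact: reg_ge0.
  + move=> a b; rewrite /= !in_itv/= !andbT => a0 _ ab.
    exact: reg_nondecreasing.
  + exact: reg_cadlag.
  + apply/eqP; rewrite eq_le; apply/andP; split; last exact: reg_ge0.
    apply/(regulator_le _ _ (lexx 0)); split => // s /andP[s0 s0'].
    have -> : s = 0 by apply/eqP; rewrite eq_le s0 s0'.
    by rewrite /netput W0 !mulr0 subr0 addr0 oppr_le0.
- exact: regulator_adapted.
- move=> t w t0; rewrite /reflected addrC -lerBlDr sub0r.
  by have [_] := (regulator_le _ w t0).1 (lexx _); apply; rewrite t0/=.
Qed.

Lemma regulator_minimal Y K t w : admissible W sigma x u Y K -> 0 <= t ->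
  regulator W sigma x u t w <= K t w.
Proof.
move=> [KP _ YE Y0] t0; have [K0 Knd _ _] := KP w.
rewrite regulatorE.
apply: (@reg_min _ _ (@netput_continuous w) (K ^~ w)) => //.
- move=> r s r0 rs; apply: Knd => //=; rewrite in_itv/= andbT//.
  exact: le_trans rs.
- by move=> s s0; rewrite -YE// Y0.
Qed.

Lemma reflected_minimal Y K t w : admissible W sigma x u Y K -> 0 <= t ->
  reflected W sigma x u t w <= Y t w.
Proof.
move=> YK t0; have [_ _ YE _] := YK.
by rewrite YE// lerD2l; exact: regulator_minimal YK t0.
Qed.

Lemma reflected_ge0 t w : 0 <= t -> 0 <= reflected W sigma x u t w.
Proof.
move=> t0; rewrite /reflected addrC -lerBlDr sub0r.
by have [_] := (regulator_le _ w t0).1 (lexx _); apply; rewrite t0/=.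
Qed.

End skorokhod.

Lemma same_rays_law d (Omega : measurableType d) (R : realType)
    (P : probability Omega R) (X Y : Omega -> R) :
  measurable_fun [set: Omega] X -> measurable_fun [set: Omega] Y ->
  (forall z, P [set w | X w <= z] = P [set w | Y w <= z]) ->
  forall A : set R, measurable A -> P (X @^-1` A) = P (Y @^-1` A).
Proof.
move=> mX mY XY A mA.
pose m1 := image_measure P mX; pose m2 := image_measure P mY.
change (m1 A = m2 A).
have ray (Z : Omega -> R) z : measurable_fun [set: Omega] Z ->
    P (Z @^-1` `]z, +oo[) = (1 - P [set w | (Z w <= z)%R])%E.
  move=> mZ; rewrite -probability_setC; last first.
    rewrite [X in measurable X](_ : _ = Z @^-1` `]-oo, z]).
      by rewrite -[_ @^-1` _]setTI; exact: mZ.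
    by apply/seteqP; split => w /=; rewrite in_itv.
  congr (P _); apply/seteqP; split => w /=; rewrite in_itv/= andbT ltNge.
    by move/negP.
  by move/negP.
apply: (measure_unique (@RGenOInfty.G R) (fun n => `]- n%:R, +oo[%classic)) => //.
- exact: RGenOInfty.measurableE.
- move=> _ _ [a ->] [b ->]; exists (Num.max a b).
  apply/seteqP; split => z /=; rewrite !in_itv/= !andbT gt_max.
    by move=> [-> ->].
  by move=> /andP[].
- by move=> n; exists (- n%:R).
- apply/seteqP; split => // z _; exists (Num.bound `|z|) => //=.
  rewrite in_itv/= andbT ltrNl (le_lt_trans _ (archi_boundP (normr_ge0 z)))//.
  by rewrite -normrN ler_norm.
- move=> _ [z ->]; have := ray X z mX; have := ray Y z mY.
  by rewrite -XY /m1 /m2 /image_measure => <-.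
- move=> n; apply: (@le_lt_trans _ _ 1%E); last exact: ltry.
  by apply: probability_le1; rewrite -[_ @^-1` _]setTI; apply: (mX measurableT).
Qed.

Section reflected_bounds.
Context d (Omega : measurableType d) (R : realType) (P : probability Omega R).
Variables (W : R -> {RV P >-> R}).
Hypothesis W_cont : forall w, {within `[0, +oo[, continuous (fun t => W t w)}.
Hypothesis W0 : forall w, W 0 w = 0.
Variables (sigma : R -> R) (x u : R).
Hypothesis x0 : 0 <= x.

Let netputD t w : netput W sigma x u t w = x + netput W sigma 0 u t w.
Proof. by rewrite /netput; ring. Qed.

(** Started from 0, the process is the largest increment of the netput from a past time [s] to [t],
    the form suited to time reversal. The 0 in the regulator is the case [s = 0], and [0 <= z] is
    the case [s = t]. *)
Lemma reflected0_le t z w : 0 <= t -> reflected W sigma 0 u t w <= z <->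
  0 <= z /\ forall s, 0 <= s <= t ->
    netput W sigma 0 u t w - netput W sigma 0 u s w <= z.
Proof.
move=> t0; rewrite /reflected -lerBrDl; split.
- move=> /(regulator_le W_cont _ _ _ _ _ t0)[z0 yz].
  have le_z s : 0 <= s <= t -> netput W sigma 0 u t w - netput W sigma 0 u s w <= z.
    by move=> st; have := yz s st; lra.
  by split => //; have := le_z t; rewrite t0 lexx subrr; exact.
- move=> [z0 yz]; apply/(regulator_le W_cont _ _ _ _ _ t0).
  split; last by move=> s st; have := yz s st; lra.
  by have := yz 0; rewrite lexx t0 {2}/netput W0 => /(_ isT); lra.
Qed.

Lemma reflected0_le_reflected t w : 0 <= t ->
  reflected W sigma 0 u t w <= reflected W sigma x u t w.
Proof.
move=> t0; rewrite /reflected netputD.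
suff : regulator W sigma 0 u t w <= x + regulator W sigma x u t w by lra.
have [L0 yL] := (regulator_le W_cont sigma x u (regulator W sigma x u t w) w t0).1 (lexx _).
apply/(regulator_le W_cont _ _ _ _ _ t0); split; first by rewrite addr_ge0.
by move=> s st; have := yL s st; rewrite netputD; lra.
Qed.

(** The regulator from [x] is the positive part of the regulator from 0 minus [x]: where it vanishes
    the process is its netput, elsewhere it equals the process from 0. *)
Lemma reflected_le_max t w : 0 <= t -> reflected W sigma x u t w <=
  Num.max (reflected W sigma 0 u t w) (netput W sigma x u t w).
Proof.
move=> t0; rewrite {1}/reflected -lerBrDl.
set m := Num.max _ _.
have m1 : reflected W sigma 0 u t w <= m by rewrite /m le_max lexx.
have m2 : netput W sigma x u t w <= m by rewrite /m le_max lexx orbT.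
apply/(regulator_le W_cont _ _ _ _ _ t0); split; first by lra.
have [_ yL] := (reflected0_le m w t0).1 m1.
by move=> s st; have := yL s st; rewrite !netputD; lra.
Qed.

End reflected_bounds.

(** * Law of the reflected process *)

Section time_reversal.
Context d (Omega : measurableType d) (R : realType) (P : probability Omega R).
Variables (H : R) (H_range : 2^-1 <= H < 1).
Variables (W : R -> {RV P >-> R}) (W_fbm : fractional_brownian_motion H W).
Variables (sigma : R -> R) (u : R).
Hypothesis sigma0 : 0 < sigma u.

Let W_cont w : {within `[0, +oo[, continuous (fun t => W t w)}.
Proof. by have [_ _ cW _ _] := W_fbm; exact: cW. Qed.

Let W0 w : W 0 w = 0.
Proof. by have [_ W0 _ _ _] := W_fbm; exact: W0. Qed.

(** The maximum of [W s - v * s] over [[0, L]], nonnegative because [W] starts at 0; written as a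
    regulator to inherit its lemmas. *)
Definition drift_max (v L : R) (w : Omega) : R := reg (fun s => v * s - W s w) L.

Let drift_cont v w : {within `[0, +oo[, continuous (fun s : R => v * s - W s w)}.
Proof.
have lin : continuous (fun t : R => v * t).
  by move=> t; apply: cvgM; [exact: cvg_cst|exact: cvg_id].
move=> t; apply: cvgB; first exact: (continuous_subspaceT lin).
exact: W_cont.
Qed.

Lemma drift_max_le v L z w : 0 <= L -> drift_max v L w <= z <->
  0 <= z /\ forall s, 0 <= s <= L -> W s w - v * s <= z.
Proof.
move=> L0; split=> [/(reg_le (@drift_cont v w) z L0)[z0 Wz]|[z0 Wz]].
  by split => // s sL; have := Wz s sL; lra.
apply/(reg_le (@drift_cont v w) z L0); split => // s sL.
by have := Wz s sL; lra.
Qed.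

Lemma drift_max_le_dense v L z w : 0 <= L -> drift_max v L w <= z <->
  0 <= z /\ forall k, W (clip L (rat_time k)) w - v * clip L (rat_time k) <= z.
Proof.
move=> L0; split=> [/(drift_max_le _ _ _ L0)[z0 Wz]|[z0 Wz]].
  by split => // k; apply: Wz; exact: clip_itv.
apply/(drift_max_le _ _ _ L0); split => //.
apply/(@dense_times_le _ (fun s => W s w - v * s)) => // s.
have -> : (fun s => W s w - v * s) = (fun s => - (v * s - W s w)).
  by apply/funext => r; rewrite opprB.
by apply: cvgN; exact: drift_cont.
Qed.

(** The time scale on which [sigma u * W r] has the law of [W (a * r)]; [scaled_drift H sigma u] is
    [u / a]. *)
Let a : R := sigma u `^ H^-1.

Let a0 : 0 < a. Proof. by rewrite powR_gt0. Qed.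

Let H0 : 0 < H. Proof. by case/andP: H_range; lra. Qed.

Let aH : a `^ (2 * H) = sigma u ^+ 2.
Proof. by rewrite /a -powRrM mulrCA mulVf ?gt_eqF// mulr1 powR_mulrn// ltW. Qed.

Section fixed_time.
Variable t : R.
Hypothesis t0 : 0 <= t.

Let r (k : nat) : R := clip (t * a) (rat_time k).

Let ta0 : 0 <= t * a. Proof. by rewrite mulr_ge0// ltW. Qed.

Let r_itv k : 0 <= r k <= t * a. Proof. exact: clip_itv. Qed.

(** Time run backwards from [t]: [r = 0] is the present and [r = t * a] the origin. *)
Let s (k : nat) : R := t - r k / a.

Let s_itv k : 0 <= s k <= t.
Proof.
have /andP[r0 rta] := r_itv k; apply/andP; split.
  by rewrite subr_ge0 ler_pdivrMr.
by rewrite gerBl divr_ge0// ltW.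
Qed.

Let U (k : nat) (w : Omega) : R := sigma u * (W t w - W (s k) w).

Let V (k : nat) (w : Omega) : R := W (r k) w.

Let Ulin k : seq (R * R) := [:: (sigma u, t); (- sigma u, s k)].

Let UE k w : U k w = linform (Ulin k) (abs_time W ^~ w).
Proof.
have /andP[s0 _] := s_itv k.
by rewrite /linform !big_cons big_nil/= /abs_time !ger0_norm// /U; ring.
Qed.

Let VE k w : V k w = abs_time W (r k) w.
Proof. by have /andP[r0 _] := r_itv k; rewrite /abs_time ger0_norm. Qed.

Let gfW := fbm_family W_fbm.

Let gfU : centered_gaussian_family P U.
Proof.
have [mW gW _] := gfW; split.
- move=> k; have -> : U k = (fun w => linform (Ulin k) (abs_time W ^~ w)).
    by apply/funext => w; exact: UE.
  exact: linform_measurable.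
- move=> l.
  pose l' := flatten [seq [seq (p.1 * q.1, q.2) | q <- Ulin p.2] | p <- l].
  have -> : (fun w => linform l (U ^~ w)) = (fun w => linform l' (abs_time W ^~ w)).
    apply/funext => w; rewrite /linform big_flatten big_map; apply: eq_bigr => p _.
    by rewrite UE /linform big_map mulr_sumr; apply: eq_bigr => q _; rewrite mulrA.
  exact: gW.
- by move=> k; under eq_integral do rewrite UE; exact: linform_integral.
Qed.

Let gfV : centered_gaussian_family P V.
Proof.
have [mW gW EW] := gfW; split.
- by move=> k; exact: measurable_funP.
- move=> l; pose l' := [seq (p.1, r p.2) | p <- l].
  have -> : (fun w => linform l (V ^~ w)) = (fun w => linform l' (abs_time W ^~ w)).
    by apply/funext => w; rewrite /linform big_map; apply: eq_bigr => p _; rewrite VE.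
  exact: gW.
- by move=> k; under eq_integral do rewrite VE.
Qed.

Let UV j k : (\int[P]_w (U j w * U k w)%:E = \int[P]_w (V j w * V k w)%:E)%E.
Proof.
under eq_integral do rewrite !UE.
under [RHS]eq_integral do rewrite !VE.
rewrite (linform_mul_integral _ _ gfW (fbm_covE W_fbm)) (fbm_covE W_fbm).
have /andP[sj0 sjt] := s_itv j; have /andP[sk0 skt] := s_itv k.
have /andP[rj0 _] := r_itv j; have /andP[rk0 _] := r_itv k.
congr EFin; rewrite /Ulin !big_cons !big_nil/= /fbm_cov.
rewrite !(ger0_norm t0) !(ger0_norm sj0) !(ger0_norm sk0) !(ger0_norm rj0) !(ger0_norm rk0).
have H20 : 2 * H != 0 by rewrite mulf_neq0// gt_eqF.
have i0 : 0 <= a^-1 by rewrite invr_ge0 ltW.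
have aHN : (a^-1) `^ (2 * H) = (sigma u ^+ 2)^-1.
  by rewrite -powR_inv1 ?ltW// -powRrM mulN1r powRN aH.
have dist b e : `|b / a - e / a| `^ (2 * H) = `|b - e| `^ (2 * H) / sigma u ^+ 2.
  by rewrite -mulrBl normrM (ger0_norm i0) powRM// aHN.
have tj : `|t - s j| `^ (2 * H) = r j `^ (2 * H) / sigma u ^+ 2.
  have := dist (r j) 0; rewrite mul0r !subr0 (ger0_norm rj0) => <-.
  by rewrite /s opprB addrC subrK.
have tk : `|t - s k| `^ (2 * H) = r k `^ (2 * H) / sigma u ^+ 2.
  have := dist (r k) 0; rewrite mul0r !subr0 (ger0_norm rk0) => <-.
  by rewrite /s opprB addrC subrK.
have jk : `|s k - s j| `^ (2 * H) = `|r k - r j| `^ (2 * H) / sigma u ^+ 2.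
  by rewrite -dist /s distrC; congr (`|_| `^ _); ring.
rewrite subrr normr0 powR0// (distrC (s k) t) tj tk jk.
by field; rewrite gt_eqF.
Qed.

(* Self-similarity and stationarity of the increments: W t - W (t - r / a),
   multiplied by sigma u, has the covariance of W r. *)
Lemma reflected0_law z :
  P [set w | reflected W sigma 0 u t w <= z] =
  P [set w | drift_max (scaled_drift H sigma u) (t * a) w <= z].
Proof.
have [z0|z0] := ltP z 0.
  have -> : [set w | reflected W sigma 0 u t w <= z] = set0.
    apply/seteqP; split => // w /=.
    by move=> /(reflected0_le W_cont W0 _ _ _ _ t0)[]; lra.
  have -> // : [set w | drift_max (scaled_drift H sigma u) (t * a) w <= z] = set0.
  apply/seteqP; split => // w /=.
  by move=> /(drift_max_le _ _ _ ta0)[]; lra.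
have -> : [set w | reflected W sigma 0 u t w <= z] =
    [set w | forall k, U (id k) w <= z + scaled_drift H sigma u * r k].
  have phiE w q : netput W sigma 0 u t w - netput W sigma 0 u (t - q / a) w =
      sigma u * (W t w - W (t - q / a) w) - scaled_drift H sigma u * q.
    by rewrite /netput /scaled_drift -/a; field; rewrite gt_eqF.
  apply/seteqP; split => w /=.
    move=> /(reflected0_le W_cont W0 _ _ _ _ t0)[_ yz] k.
    by have := yz _ (s_itv k); rewrite phiE /U -/(s k); lra.
  move=> Uz; apply/(reflected0_le W_cont W0 _ _ _ _ t0); split => // q qt.
  (* The absolute value makes [y] continuous on the whole half line, [t - q / a] being negative
     beyond [t * a]; on [[0, t * a]] it changes nothing. *)
  pose y q := netput W sigma 0 u t w - netput W sigma 0 u `|t - q / a| w.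
  have yc : {within `[0, +oo[, continuous y}.
    apply: continuous_subspaceT => b; apply: cvgB; first exact: cvg_cst.
    have gc := within_continuous_norm (@netput_continuous _ _ _ _ _ W_cont sigma 0 u w).
    have bc : t - b' / a @[b' --> b] --> t - b / a.
      by apply: cvgB; [exact: cvg_cst|apply: cvgM; [exact: cvg_id|exact: cvg_cst]].
    exact: (continuous_cvg _ (gc _) bc).
  have := (dense_times_le z yc ta0).2.
  have -> : netput W sigma 0 u t w - netput W sigma 0 u q w = y ((t - q) * a).
    by rewrite /y mulfK ?gt_eqF// subKr ger0_norm//; case/andP: qt.
  apply.
    move=> k; rewrite /y ger0_norm; last by case/andP: (s_itv k).
    by rewrite phiE -/(r k) -/(s k); have := Uz k; rewrite /U; lra.
  by case/andP: qt => q0 qt; rewrite mulr_ge0 ?subr_ge0 ?(ltW a0)//= ler_pM2r// gerBl.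
have -> : [set w | drift_max (scaled_drift H sigma u) (t * a) w <= z] =
    [set w | forall k, V (id k) w <= z + scaled_drift H sigma u * r k].
  apply/seteqP; split => w /=.
    move=> /(drift_max_le_dense _ _ _ ta0)[_ Wz] k.
    by have := Wz k; rewrite /V -/(r k); lra.
  move=> Vz; apply/(drift_max_le_dense _ _ _ ta0); split => // k.
  by have := Vz k; rewrite /V -/(r k); lra.
exact: gaussian_family_forall_le.
Qed.

End fixed_time.
End time_reversal.

Section measurability.
Context d (Omega : measurableType d) (R : realType) (P : probability Omega R).
Variables (H : R) (H_range : 2^-1 <= H < 1).
Variables (W : R -> {RV P >-> R}) (W_fbm : fractional_brownian_motion H W).

Lemma fbm_path_continuous w : {within `[0, +oo[, continuous (fun t => W t w)}.
Proof. by have [_ _ cW _ _] := W_fbm; exact: cW. Qed.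

Lemma fbm_start w : W 0 w = 0.
Proof. by have [_ W0 _ _ _] := W_fbm; exact: W0. Qed.

Lemma netput_measurable sigma x u t :
  measurable_fun [set: Omega] (netput W sigma x u t).
Proof.
by apply: measurable_funD => //; apply: measurable_funM.
Qed.

Let measurable_forall_le (Y : R -> Omega -> R) (L z : R) :
  (forall s, measurable_fun [set: Omega] (Y s)) ->
  measurable [set w | forall k, Y (clip L (rat_time k)) w <= z].
Proof.
move=> mY; rewrite (_ : [set _ | _] = \bigcap_k
    (Y (clip L (rat_time k)) @^-1` `]-oo, z])).
  by apply: bigcapT_measurable => k; rewrite -[_ @^-1` _]setTI; exact: mY.
apply/seteqP; split => w /= Yz; first by move=> k _ /=; rewrite in_itv/=.
by move=> k; have := Yz k I; rewrite /= in_itv.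
Qed.

Lemma regulator_measurable sigma x u t : 0 <= t ->
  measurable_fun [set: Omega] (regulator W sigma x u t).
Proof.
move=> t0; apply: measurable_fun_rays => z.
have mN : forall s, measurable_fun [set: Omega] (fun w => - netput W sigma x u s w).
  by move=> s; apply: measurable_funN => //; exact: netput_measurable.
have [z0|z0] := leP 0 z.
  rewrite (_ : [set _ | _] =
    [set w | forall k, - netput W sigma x u (clip t (rat_time k)) w <= z]).
    exact: (@measurable_forall_le (fun s w => - netput W sigma x u s w)).
  apply/seteqP; split => w /=.
    by move=> /(regulator_le_dense fbm_path_continuous _ _ _ _ _ t0)[].
  by move=> h; apply/(regulator_le_dense fbm_path_continuous _ _ _ _ _ t0).
rewrite (_ : [set _ | _] = set0); first exact: measurable0.
apply/seteqP; split => // w /=.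
by move=> /(regulator_le_dense fbm_path_continuous _ _ _ _ _ t0)[]; lra.
Qed.

Lemma reflected_measurable sigma x u t : 0 <= t ->
  measurable_fun [set: Omega] (reflected W sigma x u t).
Proof.
by move=> t0; apply: measurable_funD;
  [exact: netput_measurable|exact: regulator_measurable].
Qed.

Lemma drift_max_measurable v L : 0 <= L ->
  measurable_fun [set: Omega] (drift_max W v L).
Proof.
move=> L0; apply: measurable_fun_rays => z.
have [z0|z0] := leP 0 z.
  rewrite (_ : [set _ | _] = [set w | forall k,
      W (clip L (rat_time k)) w - v * clip L (rat_time k) <= z]).
    by apply: (@measurable_forall_le (fun s w => W s w - v * s)) => s;
      exact: measurable_funB.
  apply/seteqP; split => w /=.
    by move=> /(drift_max_le_dense W_fbm _ _ _ L0)[].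
  by move=> h; apply/(drift_max_le_dense W_fbm _ _ _ L0).
rewrite (_ : [set _ | _] = set0); first exact: measurable0.
by apply/seteqP; split => // w /= /(drift_max_le W_fbm _ _ _ L0)[]; lra.
Qed.

Lemma drift_max_ge0 v L w : 0 <= L -> 0 <= drift_max W v L w.
Proof. by move=> L0; have [] := (drift_max_le W_fbm v _ w L0).1 (lexx _). Qed.

Lemma drift_max_ge v L s w : 0 <= s <= L -> W s w - v * s <= drift_max W v L w.
Proof.
move=> /[dup] sL /andP[s0 sL']; have L0 := le_trans s0 sL'.
by have [_] := (drift_max_le W_fbm v _ w L0).1 (lexx _); apply.
Qed.

Lemma drift_max_nondecreasing v L L' w : 0 <= L -> L <= L' ->
  drift_max W v L w <= drift_max W v L' w.
Proof.
move=> L0 LL; have L'0 := le_trans L0 LL.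
apply/(drift_max_le W_fbm _ _ _ L0); split; first exact: drift_max_ge0.
by move=> s /andP[s0 sL]; apply: drift_max_ge; rewrite s0 (le_trans sL).
Qed.

Definition drift_bounded (v : R) (w : Omega) : Prop :=
  exists M, forall s, 0 <= s -> W s w - v * s <= M.

Lemma max_drifted_le v w z : drift_bounded v w ->
  max_drifted W v w <= z <-> forall s, 0 <= s -> W s w - v * s <= z.
Proof.
move=> [M WM]; set A := [set W s w - v * s | s in `[0, +oo[].
have supA : has_sup A.
  split; first by exists (W 0 w - v * 0), 0 => //=; rewrite in_itv/= lexx.
  by exists M => _ [s + <-]; rewrite /= in_itv/= andbT; exact: WM.
split=> [Wz s s0|Wz].
  by rewrite (le_trans _ Wz)//; apply: (sup_upper_bound supA); exists s => //=; rewrite in_itv/= s0.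
by apply: ge_sup; [exact: supA.1|move=> _ [s + <-]; rewrite /= in_itv/= andbT; exact: Wz].
Qed.

Lemma max_drifted_ge v w s : drift_bounded v w -> 0 <= s ->
  W s w - v * s <= max_drifted W v w.
Proof. by move=> b s0; apply: (max_drifted_le (max_drifted W v w) b).1. Qed.

(** The supremum of an unbounded set defaults to 0, which keeps [max_drifted] nonnegative on the
    exceptional event as well. *)
Lemma max_drifted_unbounded v w : ~ drift_bounded v w -> max_drifted W v w = 0.
Proof.
move=> nb; rewrite /max_drifted sup_out// => -[_ [M AM]]; apply: nb.
by exists M => s s0; apply: AM; exists s => //=; rewrite in_itv/= s0.
Qed.

Lemma max_drifted_ge0 v w : 0 <= max_drifted W v w.
Proof.
have [b|/max_drifted_unbounded ->//] := pselect (drift_bounded v w).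
by have := max_drifted_ge b (lexx 0); rewrite fbm_start mulr0 subr0.
Qed.

Lemma drift_max_le_max_drifted v w L : drift_bounded v w -> 0 <= L ->
  drift_max W v L w <= max_drifted W v w.
Proof.
move=> b L0; apply/(drift_max_le W_fbm _ _ _ L0); split.
  exact: max_drifted_ge0.
by move=> s /andP[s0 _]; exact: max_drifted_ge.
Qed.

(** Countable quantifiers, whence measurability of the event. *)
Let drift_boundedP v w : drift_bounded v w <->
  exists M : nat, forall n : nat, drift_max W v n%:R w <= M%:R.
Proof.
split=> [[M WM]|[M WM]].
  exists (Num.bound `|M|) => n; apply/(drift_max_le W_fbm _ _ _ (ler0n _ _)).
  split => // s /andP[s0 _]; rewrite (le_trans (WM s s0))//.
  by rewrite (le_trans (ler_norm _))// ltW// archi_boundP.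
exists M%:R => s s0; apply: le_trans (WM (Num.bound s)).
by apply: drift_max_ge; rewrite s0 ltW// archi_boundP.
Qed.

Lemma max_drifted_measurable v : measurable_fun [set: Omega] (max_drifted W v).
Proof.
have mE n z : measurable [set w | drift_max W v n%:R w <= z].
  rewrite (_ : [set _ | _] = drift_max W v n%:R @^-1` `]-oo, z]).
    by rewrite -[_ @^-1` _]setTI; exact: drift_max_measurable.
  by apply/seteqP; split => w /=; rewrite in_itv.
have mb : measurable [set w | drift_bounded v w].
  rewrite (_ : [set _ | _] = \bigcup_(M : nat) \bigcap_(n : nat)
      [set w | drift_max W v n%:R w <= M%:R]).
    apply: bigcupT_measurable => M; apply: bigcapT_measurable => n; exact: mE.
  apply/seteqP; split => w /=.
    by move=> /drift_boundedP[M WM]; exists M => // n _; exact: WM.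
  by move=> [M _ WM]; apply/drift_boundedP; exists M => n; exact: WM.
apply: measurable_fun_rays => z; have [z0|z0] := leP 0 z; last first.
  rewrite (_ : [set _ | _] = set0); first exact: measurable0.
  apply/seteqP; split => // w /=; apply/negP; rewrite -ltNge.
  by rewrite (lt_le_trans z0)// max_drifted_ge0.
(* On the unbounded event [max_drifted] is 0 and [0 <= z], so this event belongs to the sublevel
   set. *)
rewrite (_ : [set _ | _] = (\bigcap_(n : nat)
    [set w | drift_max W v n%:R w <= z]) `|` ~` [set w | drift_bounded v w]).
  apply: measurableU; last exact: measurableC.
  by apply: bigcapT_measurable => n; exact: mE.
apply/seteqP; split => w /=.
  have [b|nb _] := pselect (drift_bounded v w); last by right.
  by move=> Zz; left => n _ /=; rewrite (le_trans _ Zz)// drift_max_le_max_drifted.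
move=> [Wz|/max_drifted_unbounded ->//].
have Wz' s : 0 <= s -> W s w - v * s <= z.
  move=> s0; apply: le_trans (Wz (Num.bound s) I).
  by apply: drift_max_ge; rewrite s0 ltW// archi_boundP.
by apply/max_drifted_le => //; exists z.
Qed.

Lemma drift_max_cvg v w : drift_bounded v w ->
  drift_max W v n%:R w @[n --> \oo] --> max_drifted W v w.
Proof.
move=> b; apply/cvgrPdist_le => e e0.
have [s s0 se] : exists2 s, 0 <= s & max_drifted W v w - e < W s w - v * s.
  apply: contrapT => ns; have : max_drifted W v w <= max_drifted W v w - e.
    apply/(max_drifted_le _ b) => s s0; rewrite leNgt; apply/negP => se.
    by apply: ns; exists s.
  by lra.
near=> n; have sn : s <= n%:R.
  by rewrite ltW//; near: n; exact: nbhs_infty_gtr.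
rewrite ger0_norm ?subr_ge0 ?drift_max_le_max_drifted//.
have := @drift_max_ge v n%:R s w; rewrite s0 sn => /(_ isT).
by lra.
Unshelve. all: by end_near. Qed.

Lemma ae_drift_bounded v : 0 < v -> {ae P, forall w, drift_bounded v w}.
Proof.
move=> v0; have := fbm_ae_drift_bounded H_range W_fbm.
by apply: filterS => w; exact.
Qed.

End measurability.

(** * Average cost of the reflected process *)

Section mean_costs.
Context d (Omega : measurableType d) (R : realType) (P : probability Omega R).
Variables (H : R) (H_range : 2^-1 <= H < 1).
Variables (W : R -> {RV P >-> R}) (W_fbm : fractional_brownian_motion H W).
Variables (C : R -> R) (C_ge0 : forall y, 0 <= y -> 0 <= C y).
Hypothesis C_cont : {within `[0, +oo[, continuous C}.
Hypothesis C_nondecr : nondecreasing_on `[0, +oo[ C.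

Lemma cost_le (y z : R) : 0 <= y -> y <= z -> C y <= C z.
Proof.
by move=> y0 yz; apply: C_nondecr => //=; rewrite in_itv/= andbT// (le_trans y0).
Qed.

Lemma cost_measurable (X : Omega -> R) : measurable_fun [set: Omega] X ->
  (forall w, 0 <= X w) -> measurable_fun [set: Omega] (fun w => C (X w)).
Proof.
move=> mX X0; have -> : (fun w => C (X w)) = (fun w => C `|X w|).
  by apply/funext => w; rewrite ger0_norm.
apply: (measurableT_comp (f := fun y : R => C `|y|)) mX.
by apply: continuous_measurable_fun; exact: within_continuous_norm.
Qed.

Let mCE (X : Omega -> R) : measurable_fun [set: Omega] X ->
  (forall w, 0 <= X w) -> measurable_fun [set: Omega] (fun w => (C (X w))%:E).
Proof. by move=> mX X0; apply/measurable_EFinP; exact: cost_measurable. Qed.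

Lemma mean_reflected0 sigma u t : 0 < sigma u -> 0 <= t ->
  (\int[P]_w (C (reflected W sigma 0 u t w))%:E =
   \int[P]_w (C (drift_max W (scaled_drift H sigma u) (t * sigma u `^ H^-1) w))%:E)%E.
Proof.
move=> s0 t0; set L := t * _; have L0 : 0 <= L by rewrite mulr_ge0// powR_ge0.
have X0 w := reflected_ge0 (fbm_path_continuous W_fbm) sigma 0 u w t0.
have M0 w := drift_max_ge0 W_fbm (scaled_drift H sigma u) w L0.
have -> : (\int[P]_w (C (reflected W sigma 0 u t w))%:E =
    \int[P]_w (C `|reflected W sigma 0 u t w|)%:E)%E.
  by apply: eq_integral => w _; rewrite ger0_norm.
rewrite [RHS](_ : _ = \int[P]_w
    (C `|drift_max W (scaled_drift H sigma u) L w|)%:E)%E; last first.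
  by apply: eq_integral => w _; rewrite ger0_norm.
apply: (same_law_ge0_integral (reflected_measurable W_fbm sigma 0 u t0)
  (drift_max_measurable W_fbm (scaled_drift H sigma u) L0) _
  (f := fun y => (C `|y|)%:E)).
- apply: same_rays_law.
    exact: (reflected_measurable W_fbm sigma 0 u t0).
    exact: (drift_max_measurable W_fbm _ L0).
  by move=> z; exact: (reflected0_law H_range W_fbm s0 t0).
- apply/measurable_EFinP; apply: continuous_measurable_fun.
  exact: within_continuous_norm.
- by move=> y; rewrite lee_fin C_ge0.
Qed.

Lemma mean_costE v :
  mean_cost W C v = (\int[P]_w (C (max_drifted W v w))%:E)%E.
Proof. by rewrite /mean_cost unlock. Qed.

Lemma mean_cost_ge0 v : (0 <= mean_cost W C v)%E.
Proof.
rewrite mean_costE; apply: integral_ge0 => w _.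
by rewrite lee_fin C_ge0// (max_drifted_ge0 W_fbm).
Qed.

Lemma mean_drift_max_le v L : 0 < v -> 0 <= L ->
  (\int[P]_w (C (drift_max W v L w))%:E <= mean_cost W C v)%E.
Proof.
move=> v0 L0; rewrite mean_costE.
apply: ae_ge0_le_integral => //.
- by move=> w _; rewrite lee_fin C_ge0// (drift_max_ge0 W_fbm).
- apply: mCE; [exact: (drift_max_measurable W_fbm)|move=> w; exact: (drift_max_ge0 W_fbm)].
- by move=> w _; rewrite lee_fin C_ge0// (max_drifted_ge0 W_fbm).
- apply: mCE; [exact: (max_drifted_measurable W_fbm)|move=> w; exact: (max_drifted_ge0 W_fbm)].
- apply: filterS (ae_drift_bounded H_range W_fbm v0) => w b _.
  by rewrite lee_fin cost_le ?(drift_max_ge0 W_fbm)// (drift_max_le_max_drifted W_fbm).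
Qed.

(** Monotone convergence, phrased with a threshold below the limit so that finite and infinite mean
    costs are treated alike. *)
Lemma mean_cost_lt v (a : \bar R) : 0 < v -> (a < mean_cost W C v)%E ->
  exists n : nat, (a < \int[P]_w (C (drift_max W v n%:R w))%:E)%E.
Proof.
move=> v0 av; apply: contrapT => nan.
suff : (mean_cost W C v <= a)%E by rewrite leNgt av.
have le_a n : (\int[P]_w (C (drift_max W v n%:R w))%:E <= a)%E.
  by rewrite leNgt; apply/negP => h; apply: nan; exists n.
pose g n w := (C (drift_max W v n%:R w))%:E.
have mg n : measurable_fun [set: Omega] (g n).
  by apply: mCE; [exact: (drift_max_measurable W_fbm)|move=> w; exact: (drift_max_ge0 W_fbm)].
have g0 n w : (0 <= g n w)%E by rewrite lee_fin C_ge0// (drift_max_ge0 W_fbm).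
have ndg w : nondecreasing_seq (g ^~ w).
  move=> n m nm; rewrite lee_fin cost_le ?(drift_max_ge0 W_fbm)//.
  by rewrite (drift_max_nondecreasing W_fbm)// ler_nat.
have cg := cvg_monotone_convergence measurableT mg (fun n w _ => g0 n w)
  (fun w _ => ndg w).
have limE : mean_cost W C v = (\int[P]_w limn (g ^~ w))%E.
  rewrite mean_costE; apply: ae_eq_integral => //.
  - apply: mCE; [exact: (max_drifted_measurable W_fbm)|move=> w; exact: (max_drifted_ge0 W_fbm)].
  - apply: (emeasurable_fun_cvg g) => // w _.
    exact: (ereal_nondecreasing_is_cvgn (ndg w)).
  - apply: filterS (ae_drift_bounded H_range W_fbm v0) => w b _.
    apply/esym/cvg_lim => //; apply: cvg_EFin; first exact: nearW.
    have Cc := within_continuous_norm C_cont.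
    have -> : C (max_drifted W v w) = C `|max_drifted W v w|.
      by rewrite ger0_norm// (max_drifted_ge0 W_fbm).
    have -> : (fine \o g ^~ w) = (fun n : nat => C `|drift_max W v n%:R w|).
      by apply/funext => n /=; rewrite ger0_norm// (drift_max_ge0 W_fbm).
    exact: (continuous_cvg _ (Cc _) (drift_max_cvg W_fbm b)).
rewrite limE; apply: (cvge_to_le (cg P)); exact: nearW.
Qed.

End mean_costs.

(** * Vanishing contribution of the initial level *)

Section transient_cost.
Context d (Omega : measurableType d) (R : realType) (P : probability Omega R).
Variables (H : R) (H_range : 2^-1 <= H < 1).
Variables (W : R -> {RV P >-> R}) (W_fbm : fractional_brownian_motion H W).
Variables (C : R -> R) (C_ge0 : forall y, 0 <= y -> 0 <= C y).
Hypothesis C_nondecr : nondecreasing_on `[0, +oo[ C.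
Variables (K gamma : R).
Hypotheses (K0 : 0 < K) (gamma0 : 0 < gamma).
Hypothesis C_growth : forall y, 0 <= y -> C y <= K * (1 + y `^ gamma).
Variables (sigma : R -> R) (x u : R).
Hypotheses (x0 : 0 <= x) (u0 : 0 < u) (sigma0 : 0 < sigma u).

(** By [reflected_le_max], the most that starting from [x] can add to the cost of the process
    started from 0. *)
Definition transient_cost (t : R) (w : Omega) : R :=
  if 0 <= netput W sigma x u t w then C (netput W sigma x u t w) else 0.

Lemma transient_cost_ge0 t w : 0 <= transient_cost t w.
Proof. by rewrite /transient_cost; case: ifPn => // /C_ge0. Qed.

Let V (t : R) (w : Omega) : R := x + sigma u * `|W t w|.

Let V0 t w : 0 <= V t w.
Proof. by rewrite addr_ge0// mulr_ge0// ltW. Qed.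

(** An integer exponent above [gamma], which brings the growth of [C] down to integer moments. *)
Let n := Num.bound gamma.

Let growth y : 0 <= y -> C y <= K * (2 + y ^+ n).
Proof.
move=> y0; rewrite (le_trans (C_growth y0))// ler_pM2l//.
have yn0 : 0 <= y ^+ n by rewrite exprn_ge0.
have gn : gamma <= n%:R by rewrite ltW// archi_boundP// ltW.
suff : y `^ gamma <= 1 + y ^+ n by lra.
have [y1|y1] := leP 1 y.
  by rewrite ler_wpDl// -powR_mulrn// ler_powR.
have [->|y_neq0] := eqVneq y 0; first by rewrite powR0 ?gt_eqF// ?addr_ge0 ?exprn_ge0.
have y01 : 0 < y <= 1 by rewrite lt_neqAle eq_sym y_neq0 y0/= ltW.
have : y `^ gamma <= 1 by rewrite -(powRr0 y) ger_powR// ltW.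
lra.
Qed.

(* A nonnegative [x - u t + sigma W t] forces [u t <= V t], whence a factor
   [(V t / (u t)) ^ p] with [p] arbitrary. *)
Let transient_le p t w : 0 <= t -> 0 < (u * t) ^+ p ->
  transient_cost t w <= K * (2 * V t w ^+ p + V t w ^+ (p + n)) / (u * t) ^+ p.
Proof.
move=> t0 utp; have Vp0 k : 0 <= V t w ^+ k by rewrite exprn_ge0.
rewrite ler_pdivlMr// /transient_cost; case: ifPn => [y0|_]; last first.
  by rewrite mul0r mulr_ge0 ?addr_ge0 ?mulr_ge0// ltW.
have ut0 : 0 <= u * t by rewrite mulr_ge0// ltW.
have WV : x + sigma u * W t w <= V t w.
  by rewrite lerD2l ler_pM2l// ler_norm.
have yV : netput W sigma x u t w <= V t w by move: WV; rewrite /netput; lra.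
have utV : u * t <= V t w by move: y0 WV; rewrite /netput; lra.
have CV : C (netput W sigma x u t w) <= K * (2 + V t w ^+ n).
  rewrite (le_trans _ (growth (V0 t w)))//.
  by apply: C_nondecr => //=; rewrite in_itv/= andbT.
rewrite exprD (_ : K * _ = K * (2 + V t w ^+ n) * V t w ^+ p); last by ring.
by apply: ler_pM => //; [exact: C_ge0|exact: ltW|rewrite lerXn2r ?nnegrE].
Qed.

Let A (j : nat) : R := 2 ^+ j * (x ^+ j + sigma u ^+ j * gaussian_ratio R j).

Let A0 j : 0 <= A j.
Proof.
rewrite mulr_ge0 ?exprn_ge0// addr_ge0 ?exprn_ge0// mulr_ge0 ?gaussian_ratio_ge0//.
by rewrite exprn_ge0// ltW.
Qed.

Let mW j t : measurable_fun [set: Omega] (fun w => (`|W t w| ^+ j)%:E).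
Proof.
by apply/measurable_EFinP; apply: measurable_funX; exact: measurableT_comp.
Qed.

Let mV j t : measurable_fun [set: Omega] (fun w => (V t w ^+ j)%:E).
Proof.
apply/measurable_EFinP; apply: measurable_funX; apply: measurable_funD => //.
by apply: measurable_funM => //; exact: measurableT_comp.
Qed.

Let V_moment j t b : 0 <= t -> 1 <= b -> t `^ H <= b ->
  (\int[P]_w (V t w ^+ j)%:E <= (A j * b ^+ j)%:E)%E.
Proof.
move=> t0 b1 tb; have s0 : 0 <= sigma u ^+ j by rewrite exprn_ge0// ltW.
have xj0 : 0 <= x ^+ j by rewrite exprn_ge0.
have j20 : 0 <= 2 ^+ j :> R by rewrite exprn_ge0.
apply: (@le_trans _ _ (\int[P]_w ((2 ^+ j * x ^+ j)%:E +
    (2 ^+ j * sigma u ^+ j)%:E * (`|W t w| ^+ j)%:E))%E).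
  apply: le_lower_integral => w _; first by rewrite lee_fin exprn_ge0.
  rewrite -EFinM -EFinD lee_fin -mulrA -mulrDr -exprMn.
  by apply: exprD_le => //; rewrite mulr_ge0// ltW.
rewrite ge0_integralD//; last 3 first.
- by move=> w _; rewrite lee_fin mulr_ge0.
- by move=> w _; rewrite mule_ge0 ?lee_fin ?exprn_ge0// mulr_ge0.
- exact: emeasurable_funM.
rewrite probability_integral_cst ge0_integralZl_EFin//; last by rewrite mulr_ge0.
rewrite (fbm_moment H_range W_fbm j t0) -EFinM -EFinD lee_fin.
have bj : (t `^ H) ^+ j <= b ^+ j.
  by rewrite lerXn2r ?nnegrE ?powR_ge0// (le_trans _ b1).
have b1j : 1 <= b ^+ j by rewrite exprn_ege1.
have r0 := gaussian_ratio_ge0 R j.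
rewrite /A [leRHS](_ : _ = 2 ^+ j * x ^+ j * b ^+ j +
  2 ^+ j * sigma u ^+ j * (gaussian_ratio R j * b ^+ j)); last by ring.
rewrite lerD//; first by rewrite ler_peMr// mulr_ge0.
by rewrite ler_wpM2l ?mulr_ge0// ler_wpM2l.
Qed.

Let D (p : nat) : R := K * (2 * A p + A (p + n)).

Let D0 p : 0 <= D p.
Proof. by apply: mulr_ge0; [exact: ltW|apply: addr_ge0 => //; exact: mulr_ge0]. Qed.

Let transient_bound p t b : 0 <= t -> 0 < (u * t) ^+ p -> 1 <= b -> t `^ H <= b ->
  (\int[P]_w (transient_cost t w)%:E <= (D p * b ^+ (p + n) / (u * t) ^+ p)%:E)%E.
Proof.
move=> t0 utp b1 tb; pose c : R := K / (u * t) ^+ p.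
have c0 : 0 <= c by rewrite divr_ge0// ltW.
apply: (@le_trans _ _ (\int[P]_w ((c * 2)%:E * (V t w ^+ p)%:E +
    c%:E * (V t w ^+ (p + n))%:E))%E).
  apply: le_lower_integral => w _; first by rewrite lee_fin transient_cost_ge0.
  rewrite -!EFinM -EFinD lee_fin (le_trans (transient_le w t0 utp))//.
  by rewrite le_eqVlt /c; apply/orP; left; apply/eqP; ring.
rewrite ge0_integralD//; last 4 first.
- by move=> w _; rewrite mule_ge0 ?lee_fin ?exprn_ge0// mulr_ge0.
- exact: emeasurable_funM.
- by move=> w _; rewrite mule_ge0 ?lee_fin ?exprn_ge0.
- exact: emeasurable_funM.
rewrite !ge0_integralZl_EFin//; last 3 first.
- by move=> w _; rewrite lee_fin exprn_ge0.
- by move=> w _; rewrite lee_fin exprn_ge0.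
- by rewrite mulr_ge0.
apply: (@le_trans _ _ ((c * 2)%:E * (A p * b ^+ p)%:E +
    c%:E * (A (p + n) * b ^+ (p + n))%:E)%E).
  apply: leeD.
    by apply: lee_wpmul2l; [rewrite lee_fin mulr_ge0|exact: V_moment].
  by apply: lee_wpmul2l; [rewrite lee_fin|exact: V_moment].
rewrite -!EFinM -EFinD lee_fin.
rewrite [leRHS](_ : _ = c * 2 * (A p * b ^+ (p + n)) + c * (A (p + n) * b ^+ (p + n)));
  last by rewrite /D /c; ring.
rewrite lerD2r; apply: ler_wpM2l; first by rewrite mulr_ge0.
by apply: ler_wpM2l => //; rewrite ler_weXn2l// leq_addr.
Qed.

Lemma transient_cost_vanishing (e : R) : 0 < e -> exists t1 B : R,
  [/\ 0 <= t1, 0 <= B,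
    forall t, 0 <= t <= t1 -> (\int[P]_w (transient_cost t w)%:E <= B%:E)%E &
    forall t, t1 <= t -> (\int[P]_w (transient_cost t w)%:E <= e%:E)%E].
Proof.
move=> e0; have /andP[H2 H1] := H_range; have H0 : 0 < H by lra.
(* Chosen so that [p (1 - H) > H n]: the mean is then O(t^-b) with b = p - H (p + n) > 0. *)
pose p := Num.bound (H * n%:R / (1 - H)).
pose b := p%:R - H * (p + n)%:R.
have b0 : 0 < b.
  have : H * n%:R / (1 - H) < p%:R.
    by rewrite archi_boundP// divr_ge0 ?mulr_ge0 ?ltW// subr_gt0.
  by rewrite ltr_pdivrMr ?subr_gt0// /b natrD; lra.
pose E := D p / u ^+ p.
have E0 : 0 <= E by rewrite divr_ge0// exprn_ge0// ltW.
(* From this time on E / t^b <= e, and t^H >= 1. Before it, the same estimate with exponent 0 in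
   place of [p] gives a constant bound. *)
pose t1 := Num.max 1 ((E / e) `^ b^-1).
have t1_ge1 : 1 <= t1 by rewrite /t1 le_max lexx.
exists t1, (D 0 * (t1 `^ H) ^+ (0 + n)).
have t1H : 1 <= t1 `^ H by rewrite -(powRr0 t1) ler_powR// ltW.
split.
- by rewrite (le_trans _ t1_ge1).
- by rewrite mulr_ge0// exprn_ge0// (le_trans _ t1H).
- move=> t /andP[t0 tt1].
  have := @transient_bound 0 t (t1 `^ H) t0; rewrite !expr0 divr1.
  apply => //; rewrite ge0_ler_powR ?nnegrE ?(ltW H0)//.
  by rewrite (le_trans t0).
- move=> t t1t; have t_ge1 : 1 <= t by rewrite (le_trans t1_ge1).
  have t_gt0 : 0 < t by rewrite (lt_le_trans _ t_ge1).
  have tH : 1 <= t `^ H by rewrite -(powRr0 t) ler_powR// ltW.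
  apply: (le_trans (@transient_bound p t (t `^ H) _ _ tH (lexx _))).
  + exact: ltW.
  + by rewrite exprn_gt0// mulr_gt0.
  rewrite lee_fin.
  have -> : D p * (t `^ H) ^+ (p + n) / (u * t) ^+ p = E / t `^ b.
    rewrite exprMn -[(t `^ H) ^+ _]powR_mulrn ?powR_ge0// -powRrM.
    rewrite -[t ^+ p]powR_mulrn ?ltW// /b powRB; last first.
      by rewrite (gt_eqF t_gt0) implybT.
    by rewrite /E; field; rewrite ?expf_neq0 ?gt_eqF ?powR_gt0.
  rewrite ler_pdivrMr ?powR_gt0// mulrC -ler_pdivrMr//.
  have Ee0 : 0 <= E / e by rewrite divr_ge0// ltW.
  have -> : E / e = ((E / e) `^ b^-1) `^ b.
    by rewrite -powRrM mulVf ?powRr1// gt_eqF.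
  rewrite ge0_ler_powR ?nnegrE ?powR_ge0 ?(ltW b0) ?(ltW t_gt0)//.
  by rewrite (le_trans _ t1t)// /t1 le_max lexx orbT.
Qed.

End transient_cost.

(** The process is the pointwise limit of copies frozen at the grid times of step 1/(n+1); such a
    copy is measurable cell by cell. *)
Lemma continuous_process_measurable d (Omega : measurableType d) (R : realType)
    (F : R -> Omega -> R) :
  (forall w, continuous (fun t : R => F `|t| w)) ->
  (forall t, 0 <= t -> measurable_fun [set: Omega] (F t)) ->
  measurable_fun [set: measurableTypeR R * Omega]
    (fun p : measurableTypeR R * Omega => F `|p.1 : R| p.2).
Proof.
move=> Fc mF.
pose k (n : nat) (t : R) : nat := Num.truncn (n.+1%:R * `|t|).
have k_itv n t : (k n t)%:R <= n.+1%:R * `|t| < (k n t).+1%:R.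
  by apply: truncn_itv; rewrite mulr_ge0.
pose G n (p : measurableTypeR R * Omega) := F ((k n p.1)%:R / n.+1%:R) p.2.
have mG n : measurable_fun [set: measurableTypeR R * Omega] (G n).
  apply: measurable_fun_rays => z.
  pose E (j : nat) : set (measurableTypeR R) :=
    (fun t : R => n.+1%:R * `|t|) @^-1` `[j%:R, j.+1%:R[.
  rewrite (_ : [set _ | _] = \bigcup_(j : nat)
      (E j `*` [set w | F (j%:R / n.+1%:R) w <= z])).
    apply: bigcupT_measurable => j; apply: measurableX.
      have mn : measurable_fun [set: R] (fun t : R => n.+1%:R * `|t|).
        by apply: measurable_funM => //; exact: measurableT_comp.
      by rewrite -[E j]setTI; exact: mn.
    rewrite (_ : [set _ | _] = F (j%:R / n.+1%:R) @^-1` `]-oo, z]).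
      by rewrite -[_ @^-1` _]setTI; apply: mF; rewrite ?divr_ge0.
    by apply/seteqP; split => w /=; rewrite in_itv.
  apply/seteqP; split => -[t w] /=.
    by move=> Gz; exists (k n t) => //; split => //=; rewrite /E/= in_itv/= k_itv.
  move=> [j _ [/= Ej Fz]]; rewrite /G/=.
  have -> // : k n t = j by apply: truncn_def; move: Ej; rewrite /E/= ?in_itv.
apply: (measurable_fun_cvg mG) => -[t w] _ /=.
have kt : (k n t)%:R / n.+1%:R @[n --> \oo] --> `|t|.
  apply/cvgrPdist_le => e e0; near=> n.
  have n0 : 0 < n.+1%:R :> R by rewrite ltr0n.
  have /andP[k1 k2] := k_itv n t.
  have -> : `|t| - (k n t)%:R / n.+1%:R = (n.+1%:R * `|t| - (k n t)%:R) / n.+1%:R.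
    by field; rewrite gt_eqF.
  rewrite ger0_norm ?divr_ge0 ?subr_ge0// ler_pdivrMr//.
  have : e^-1 < n%:R by near: n; exact: nbhs_infty_gtr.
  rewrite -(ltr_pM2l e0) mulfV ?gt_eqF// => en.
  rewrite -!natr1 in k2 *; lra.
have -> : G ^~ (t, w) = (fun n => F `|(k n t)%:R / n.+1%:R| w).
  by apply/funext => n; rewrite /G/= ger0_norm.
rewrite -[`|t|]normr_id.
exact: (continuous_cvg _ (Fc w `|t|) kt).
Unshelve. all: by end_near. Qed.

Section tonelli_process.
Context d (Omega : measurableType d) (R : realType) (P : probability Omega R).

Lemma process_tonelli (F : R -> Omega -> R) (T : R) :
  (forall w, continuous (fun t : R => F `|t| w)) ->
  (forall t, 0 <= t -> measurable_fun [set: Omega] (F t)) ->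
  (forall t w, 0 <= t -> 0 <= F t w) ->
  (\int[P]_w \int[lebesgue_measure]_(t in `[0%R, T]) (F t w)%:E =
   \int[lebesgue_measure]_(t in `[0%R, T]) \int[P]_w (F t w)%:E)%E.
Proof.
move=> Fc mF F0.
pose f (p : measurableTypeR R * Omega) : \bar R :=
  ((F `|p.1 : R| p.2)%:E * (\1_(`[0%R, T]%classic : set R) p.1)%:E)%E.
have mf : measurable_fun [set: measurableTypeR R * Omega] f.
  apply: emeasurable_funM.
    by apply/measurable_EFinP; exact: continuous_process_measurable.
  have m1 : measurable_fun [set: measurableTypeR R]
    (\1_(`[0%R, T]%classic : set (measurableTypeR R)) : _ -> R).
    exact: measurable_indic.
  by apply/measurable_EFinP; exact: (measurableT_comp m1 measurable_fst).
have f0 p : (0 <= f p)%E by rewrite mule_ge0// lee_fin ?F0//.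
have tonelli := @fubini_tonelli _ _ _ _ R lebesgue_measure P f mf f0.
transitivity (\int[P]_w \int[lebesgue_measure]_t f (t, w))%E.
  apply: eq_integral => w _; rewrite integral_mkcond; apply: eq_integral => t _.
  rewrite patchE /f/= indicE; case: ifPn => [|_]; last by rewrite mule0.
  by rewrite inE/= in_itv/= => /andP[t0 _]; rewrite mule1 ger0_norm.
rewrite -tonelli [RHS]integral_mkcond; apply: eq_integral => t _.
rewrite patchE /f/= indicE; case: ifPn => [|_].
  rewrite inE/= in_itv/= => /andP[t0 _].
  by apply: eq_integral => w _; rewrite mule1 ger0_norm.
by under eq_integral do rewrite mule0; rewrite integral0.
Qed.

End tonelli_process.

(** * Long-run average of the mean running cost *)

Section long_run_cost.
Context d (Omega : measurableType d) (R : realType) (P : probability Omega R).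
Variables (H : R) (H_range : 2^-1 <= H < 1).
Variables (W : R -> {RV P >-> R}) (W_fbm : fractional_brownian_motion H W).
Variables (C : R -> R) (C_ge0 : forall y, 0 <= y -> 0 <= C y).
Hypothesis C_cont : {within `[0, +oo[, continuous C}.
Hypothesis C_nondecr : nondecreasing_on `[0, +oo[ C.
Hypothesis C_growth : exists K gamma : R, [/\ 0 < K, 0 < gamma &
  forall y, 0 <= y -> C y <= K * (1 + y `^ gamma)].
Variables (sigma h : R -> R) (x u : R).
Hypotheses (x0 : 0 <= x) (u0 : 0 < u) (sigma0 : 0 < sigma u) (hu0 : 0 <= h u).

Local Notation X := (reflected W sigma x u).
Local Notation X0 := (reflected W sigma 0 u).
Local Notation f := (scaled_drift H sigma u).
Local Notation transient := (transient_cost W C sigma x u).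

Let f0 : 0 < f. Proof. by rewrite divr_gt0// powR_gt0. Qed.

Let W_cont := fbm_path_continuous W_fbm.
Let W_0 := fbm_start W_fbm.

Let running_cost t w := h u + C (X t w).

Let mean_running t : \bar R := (\int[P]_w (running_cost t w)%:E)%E.

Let X_ge0 t w : 0 <= t -> 0 <= X t w.
Proof. exact: reflected_ge0. Qed.

Let X0_ge0 t w : 0 <= t -> 0 <= X0 t w.
Proof. exact: reflected_ge0. Qed.

Let running_cost_ge0 t w : 0 <= t -> 0 <= running_cost t w.
Proof. by move=> t0; rewrite addr_ge0// C_ge0// X_ge0. Qed.

Let mCX0 t : 0 <= t -> measurable_fun [set: Omega] (fun w => (C (X0 t w))%:E).
Proof.
move=> t0; apply/measurable_EFinP; apply: (cost_measurable C_cont).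
  exact: (reflected_measurable W_fbm).
by move=> w; exact: X0_ge0.
Qed.

Let running_cost_measurable t : 0 <= t ->
  measurable_fun [set: Omega] (running_cost t).
Proof.
move=> t0; apply: measurable_funD => //; apply: (cost_measurable C_cont).
  exact: (reflected_measurable W_fbm).
by move=> w; exact: X_ge0.
Qed.

Let running_cost_continuous w : continuous (fun t : R => running_cost `|t| w).
Proof.
have Cc := within_continuous_norm C_cont.
have Xc : continuous (fun t : R => X `|t| w).
  move=> t; apply: cvgD.
    exact: (within_continuous_norm (@netput_continuous _ _ _ _ _ W_cont sigma x u w)).
  exact: (reg_continuous (@netput_continuous _ _ _ _ _ W_cont sigma x u w)).
have -> : (fun t : R => running_cost `|t| w) = (fun t : R => h u + C `|X `|t| w|).
  by apply/funext => t; rewrite /running_cost [in RHS]ger0_norm ?X_ge0.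
move=> t; apply: cvgD; first exact: cvg_cst.
exact: (continuous_cvg _ (Cc _) (Xc t)).
Qed.

Lemma transient_measurable t : measurable_fun [set: Omega] (transient t).
Proof.
have mN := netput_measurable W sigma x u t.
have -> : transient t = (fun w => C `|netput W sigma x u t w| *
    (\1_(`[0, +oo[%classic : set R) (netput W sigma x u t w))).
  apply/funext => w; rewrite /transient_cost indicE; case: ifPn => y0.
    by rewrite ger0_norm// mem_set ?mulr1//= in_itv/= andbT.
  rewrite memNset ?mulr0//= in_itv/= andbT; exact/negP.
apply: measurable_funM.
  apply: (measurableT_comp (f := fun y : R => C `|y|)) mN.
  by apply: continuous_measurable_fun; exact: within_continuous_norm.
have m1 : measurable_fun [set: R] (\1_(`[0, +oo[%classic : set R) : R -> R).
  exact: measurable_indic.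
exact: (measurableT_comp m1 mN).
Qed.

Let mean_runningE (Y : Omega -> R) : measurable_fun [set: Omega] (EFin \o Y) ->
  (forall w, 0 <= Y w) ->
  (\int[P]_w (h u + Y w)%:E = (h u)%:E + \int[P]_w (Y w)%:E)%E.
Proof.
move=> mY Y0; under eq_integral do rewrite EFinD.
rewrite ge0_integralD//; first by rewrite probability_integral_cst.
by move=> w _; rewrite lee_fin.
Qed.

Let mean_running_ub t : 0 <= t -> (mean_running t <=
  (h u)%:E + mean_cost W C f + \int[P]_w (transient t w)%:E)%E.
Proof.
move=> t0; have tr0 w : 0 <= transient t w by exact: transient_cost_ge0.
have mtr : measurable_fun [set: Omega] (fun w => (transient t w)%:E).
  by apply/measurable_EFinP; exact: transient_measurable.
apply: (@le_trans _ _ (\int[P]_w (h u + (C (X0 t w) + transient t w))%:E)%E).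
  apply: le_lower_integral => w _; first by rewrite lee_fin running_cost_ge0.
  rewrite lee_fin lerD2l; have CX0 : 0 <= C (X0 t w) by rewrite C_ge0// X0_ge0.
  have := reflected_le_max W_cont W_0 sigma x u w t0.
  rewrite le_max => /orP[XX0|Xy].
    by rewrite (le_trans (cost_le C_nondecr (X_ge0 w t0) XX0))// lerDl.
  have y0 := le_trans (X_ge0 w t0) Xy.
  rewrite (le_trans (cost_le C_nondecr (X_ge0 w t0) Xy))//.
  by rewrite /transient_cost y0 lerDr.
rewrite mean_runningE; last 2 first.
- by apply/measurable_EFinP; apply: measurable_funD; apply/measurable_EFinP => //; exact: mCX0.
- by move=> w; rewrite addr_ge0// C_ge0// X0_ge0.
under eq_integral do rewrite EFinD.
rewrite ge0_integralD//; last 3 first.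
- by move=> w _; rewrite lee_fin C_ge0// X0_ge0.
- exact: mCX0.
- by move=> w _; rewrite lee_fin.
rewrite addeA leeD2r// leeD2l// (mean_reflected0 H_range W_fbm)//.
by apply: (mean_drift_max_le H_range W_fbm) => //; rewrite mulr_ge0// powR_ge0.
Qed.

Let mean_running_lb t L : 0 <= L -> L <= t * sigma u `^ H^-1 -> 0 <= t ->
  ((h u)%:E + \int[P]_w (C (drift_max W f L w))%:E <= mean_running t)%E.
Proof.
move=> L0 Lt t0.
apply: (@le_trans _ _ (\int[P]_w (h u + C (X0 t w))%:E)%E); last first.
  apply: le_lower_integral => w _.
    by rewrite lee_fin addr_ge0// C_ge0// X0_ge0.
  rewrite lee_fin lerD2l (cost_le C_nondecr)// ?X0_ge0//.
  exact: reflected0_le_reflected.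
rewrite mean_runningE; last 2 first.
- exact: mCX0.
- by move=> w; rewrite C_ge0// X0_ge0.
rewrite leeD2l// (mean_reflected0 H_range W_fbm)//.
apply: le_lower_integral => w _.
  by rewrite lee_fin C_ge0// (drift_max_ge0 W_fbm).
rewrite lee_fin (cost_le C_nondecr)// ?(drift_max_ge0 W_fbm)//.
exact: (drift_max_nondecreasing W_fbm).
Qed.

Let total_cost (T : R) : \bar R :=
  (\int[lebesgue_measure]_(t in `[0%R, T]) mean_running t)%E.

Let average_costE : average_cost P h C u X =
  limsup_pinfty (fun T => (T^-1)%:E * total_cost T)%E.
Proof.
rewrite /average_cost; congr limsup_pinfty; apply/funext => T; congr (_ * _)%E.
by rewrite /total_cost -process_tonelli.
Qed.

Let itv_measure (a b : R) : a <= b ->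
  (lebesgue_measure (`[a, b]%classic : set R) = (b - a)%:E)%E.
Proof.
rewrite le_eqVlt => /orP[/eqP ->|ab].
  by rewrite set_itv1 lebesgue_measure_set1 subrr.
by rewrite lebesgue_measure_itv/= lte_fin ab EFinB.
Qed.

Let average_cost_ub : (average_cost P h C u X <= (h u)%:E + mean_cost W C f)%E.
Proof.
have mc0 := mean_cost_ge0 W_fbm C_ge0 f.
have [->|mcfin] := eqVneq (mean_cost W C f) +oo%E; first by rewrite addey// leey.
have mcr : mean_cost W C f = (fine (mean_cost W C f))%:E.
  by rewrite fineK// ge0_fin_numE// ltey.
set r := fine _ in mcr; have r0 : 0 <= r by rewrite fine_ge0.
rewrite mcr -EFinD average_costE; apply/lee_addgt0Pr => e e0.
have [K [gamma [K0 gamma0 Cg]]] := C_growth.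
have e20 : 0 < e / 2 by rewrite divr_gt0.
have [t1 [B [t10 B0 tB te]]] := transient_cost_vanishing H_range W_fbm C_ge0 C_nondecr
  K0 gamma0 Cg x0 u0 sigma0 e20.
(* One half of [e] pays for the transient cost after [t1], the other for its total [B * t1] before,
   once T > B * t1 / (e/2). *)
pose c := h u + r + e / 2.
have c0 : 0 <= c by rewrite !addr_ge0// ltW.
apply: (@limsup_pinfty_ub _ _ (Num.max 1 (B * t1 / (e / 2)))) => T.
rewrite gt_max => /andP[T1 Te]; have T0 : 0 < T by rewrite (lt_trans _ T1).
rewrite lee_pdivrMl//.
apply: (@le_trans _ _ (\int[lebesgue_measure]_(t in `[0%R, T])
    (c%:E + B%:E * (\1_(`[0, t1]%classic : set R) t)%:E))%E).
  apply: le_lower_integral => t; rewrite /= in_itv/= => /andP[t0 tT].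
    by apply: integral_ge0 => w _; rewrite lee_fin running_cost_ge0.
  apply: (le_trans (mean_running_ub t0)); rewrite mcr indicE.
  have [t1t|tt1] := leP t1 t.
    apply: (@le_trans _ _ c%:E); first by rewrite /c -EFinD [leRHS]EFinD leeD2l// te.
    by rewrite leeDl// mule_ge0// lee_fin.
  rewrite mem_set/= ?mule1; last by rewrite in_itv/= t0 ltW.
  apply: leeD; last by apply: tB; rewrite t0 ltW.
  by rewrite -EFinD lee_fin /c lerDl ltW.
rewrite ge0_integralD//; last 2 first.
- by move=> t _; rewrite mule_ge0// lee_fin.
- by apply/emeasurable_funM => //; apply/measurable_EFinP; exact: measurable_indic.
rewrite integral_cst// ge0_integralZl_EFin//; last first.
  by apply/measurable_EFinP; exact: measurable_indic.
rewrite integral_indic//= itv_measure ?(ltW T0)// subr0.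
apply: (@le_trans _ _ (c%:E * T%:E + B%:E * t1%:E)%E).
  rewrite leeD2l// lee_wpmul2l ?lee_fin//.
  rewrite (le_trans (le_measure _ _ _ (@subIsetl _ _ _))) ?inE//.
    exact: measurableI.
  by have := itv_measure t10; rewrite subr0 => <-.
rewrite -!EFinM -EFinD lee_fin /c.
move: Te; rewrite ltr_pdivrMr//; nra.
Qed.

(** By contradiction: were the average [s] smaller, a finite horizon [n] would already force a mean
    running cost of at least some [b > s] from a time [t0] on, and hence a larger average. *)
Let average_cost_lb : ((h u)%:E + mean_cost W C f <= average_cost P h C u X)%E.
Proof.
have mr0 t : 0 <= t -> (0 <= mean_running t)%E.
  by move=> t0; apply: integral_ge0 => w _; rewrite lee_fin running_cost_ge0.
rewrite leNgt; apply/negP => ltA.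
have A0 : (0 <= average_cost P h C u X)%E.
  rewrite average_costE; apply: (@limsup_pinfty_lb _ _ 0) => T T0.
  apply: mule_ge0; first by rewrite lee_fin invr_ge0 ltW.
  apply: integral_ge0 => t /=.
  by rewrite in_itv/= => /andP[t0 _]; exact: mr0.
have : average_cost P h C u X \is a fin_num.
  by rewrite ge0_fin_numE// (lt_le_trans ltA)// leey.
move=> /fineK; set s := fine _ => As.
have s0 : 0 <= s by rewrite -lee_fin As.
have [n nlt] : exists n : nat,
    ((s - h u)%:E < \int[P]_w (C (drift_max W f n%:R w))%:E)%E.
  apply: (mean_cost_lt H_range W_fbm C_ge0 C_cont C_nondecr f0).
  by rewrite EFinB lteBlDr// addeC As.
pose k := ((h u)%:E + \int[P]_w (C (drift_max W f n%:R w))%:E)%E.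
(* [k] may be infinite, so a real level between [s] and [k] is taken. *)
have [b sb bk] : exists2 b, s < b & (b%:E <= k)%E.
  have sk : (s%:E < k)%E by rewrite /k addeC -lteBlDr// -EFinB.
  case: k sk => [k sk|_|//]; first by exists k => //; rewrite -lte_fin.
  by exists (s + 1); rewrite ?leey// ltrDl.
have b0 : 0 <= b by rewrite (le_trans s0)// ltW.
pose al := sigma u `^ H^-1; have al0 : 0 < al by rewrite powR_gt0.
pose t0 := n%:R / al; have t00 : 0 <= t0 by rewrite divr_ge0// ltW.
(* The midpoint leaves a margin (b - s)/2 per unit of time, which absorbs the loss [b * t0] on
   [0, t0] for large T. *)
have : (((s + b) / 2)%:E <= average_cost P h C u X)%E.
  rewrite average_costE.
  apply: (@limsup_pinfty_lb _ _ (Num.max t0 (b * t0 / ((b - s) / 2)))) => T.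
  rewrite gt_max => /andP[t0T bT]; have T0 : 0 < T by rewrite (le_lt_trans t00).
  rewrite lee_pdivlMl//.
  apply: (@le_trans _ _ (\int[lebesgue_measure]_(t in `[0%R, T])
      (b%:E * (\1_(`[t0, T]%classic : set R) t)%:E))%E).
    rewrite ge0_integralZl_EFin//; last first.
      by apply/measurable_EFinP; exact: measurable_indic.
    rewrite integral_indic//= setIidl; last first.
      by apply: subset_itvr; rewrite bnd_simp.
    rewrite itv_measure ?(ltW t0T)// -!EFinM lee_fin.
    by move: bT; rewrite ltr_pdivrMr ?divr_gt0 ?subr_gt0//; nra.
  apply: le_lower_integral => t; rewrite /= in_itv/= => /andP[t_ge0 tT].
    by rewrite mule_ge0// lee_fin.
  rewrite indicE; have [t0t|tt0] := leP t0 t; last first.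
    by rewrite memNset ?mule0 ?mr0//= in_itv/= leNgt tt0.
  rewrite mem_set/= ?mule1; last by rewrite in_itv/= t0t.
  by apply: (le_trans bk); apply: mean_running_lb => //; rewrite -ler_pdivrMr.
by rewrite -As lee_fin; lra.
Qed.

Lemma average_cost_reflected :
  (average_cost P h C u X = (h u)%:E + mean_cost W C f)%E.
Proof. by apply/eqP; rewrite eq_le average_cost_ub average_cost_lb. Qed.

End long_run_cost.

(** * Optimal control *)

Section pushing_rate.
Context d (Omega : measurableType d) (R : realType) (P : probability Omega R).
Variables (H : R) (H_range : 2^-1 <= H < 1).
Variables (W : R -> {RV P >-> R}) (W_fbm : fractional_brownian_motion H W).
Variables (sigma : R -> R) (x u : R).
Hypotheses (x0 : 0 <= x) (u0 : 0 < u) (sigma0 : 0 < sigma u).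

Let W_cont := fbm_path_continuous W_fbm.

Lemma average_push_regulator : (average_push P (regulator W sigma x u) <= u%:E)%E.
Proof.
have [c c0 supB] := fbm_sup_bound H_range W_fbm.
apply/lee_addgt0Pr => e e0.
have b0 : 0 < 1 - H by case/andP: H_range; lra.
(* The excess sigma c T^H over u T is at most e T as soon as T^(1 - H) >= q. *)
pose q := sigma u * c / e; have q0 : 0 <= q by rewrite divr_ge0 ?mulr_ge0// ltW.
apply: (@limsup_pinfty_ub _ _ (Num.max 0 (q `^ (1 - H)^-1))) => T.
rewrite gt_max => /andP[T0 qT]; have [B [mB B0 WB iB]] := supB T T0.
rewrite muleC lee_pdivrMl// unlock.
apply: (@le_trans _ _ (\int[P]_w ((u * T)%:E + (sigma u)%:E * B w))%E).
  apply: le_lower_integral => w _.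
    by rewrite lee_fin; exact: (reg_ge0 (@netput_continuous _ _ _ _ _ W_cont sigma x u w) (ltW T0)).
  have := WB w; case: (B w) (B0 w) => [b b_ge0 Wb|_ _|//]; last first.
    by rewrite gt0_muley ?lte_fin// addey// leey.
  rewrite -EFinM -EFinD lee_fin.
  apply/(regulator_le W_cont _ _ _ _ _ (ltW T0)).
  have sb0 : 0 <= sigma u * b by rewrite mulr_ge0// ltW.
  split; first by rewrite addr_ge0// mulr_ge0// ltW.
  move=> s sT; have := Wb s sT; rewrite lee_fin => Wsb.
  have sWb : - (sigma u * W s w) <= sigma u * b.
    by rewrite -mulrN ler_pM2l// (le_trans _ Wsb)// -normrN ler_norm.
  have usT : u * s <= u * T by case/andP: sT => _; rewrite ler_pM2l.
  rewrite /netput opprD opprB addrAC -addrA; apply: lerD => //.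
  by rewrite lerBlDr (le_trans sWb)// lerDl.
have uT0 : 0 <= u * T by rewrite mulr_ge0// ltW.
rewrite ge0_integralD//; last 2 first.
- by move=> w _; rewrite mule_ge0// lee_fin ltW.
- exact: emeasurable_funM.
rewrite probability_integral_cst ge0_integralZl_EFin//; last exact: ltW.
apply: (@le_trans _ _ ((u * T)%:E + (sigma u)%:E * (c * T `^ H)%:E)%E).
  by rewrite leeD2l// lee_wpmul2l// lee_fin ltW.
rewrite -EFinM -EFinD -EFinD -EFinM lee_fin mulrDr (mulrC u) lerD2l.
have -> : T * e = T `^ (1 - H) * e * T `^ H.
  by rewrite mulrAC -powRD ?subrK ?powRr1 ?(ltW T0)// (gt_eqF T0) implybT.
rewrite mulrA ler_wpM2r ?powR_ge0// -ler_pdivrMr// -/q.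
have -> : q = (q `^ (1 - H)^-1) `^ (1 - H).
  by rewrite -powRrM mulVf ?powRr1// gt_eqF.
by rewrite ge0_ler_powR ?nnegrE ?powR_ge0// ltW.
Qed.

Lemma mean_netput t : 0 <= t ->
  (\int[P]_w (- netput W sigma x u t w)%:E = (u * t - x)%:E)%E.
Proof.
move=> t0; have gf := fbm_family W_fbm.
have iW := gaussian_family_integrable t gf.
have [_ _ /(_ t) EW] := gf; move: iW EW; rewrite /abs_time (ger0_norm t0) => iW EW.
have -> : (fun w => (- netput W sigma x u t w)%:E) =
    (fun w => (u * t - x)%:E + (- sigma u)%:E * (W t w)%:E)%E.
  by apply/funext => w; rewrite -EFinM -EFinD /netput; congr EFin; ring.
rewrite integralD//; last 2 first.
- exact: finite_measure_integrable_cst.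
- exact: integrableZl.
by rewrite probability_integral_cst integralZl// EW mule0 adde0.
Qed.

Lemma drift_le_average_push Y K : admissible W sigma x u Y K ->
  (u%:E <= average_push P K)%E.
Proof.
move=> [KP _ YE Y0]; apply/lee_addgt0Pr => e e0.
rewrite -leeBlDr// -EFinB.
apply: (@limsup_pinfty_lb _ _ (Num.max 0 (x / e))) => T.
rewrite gt_max => /andP[T0 xT]; have T_ge0 := ltW T0.
rewrite muleC lee_pdivlMl// unlock -EFinM.
apply: (@le_trans _ _ (u * T - x)%:E).
  by move: xT; rewrite ltr_pdivrMr// lee_fin; lra.
(* As [K T] may fail to be measurable, it is compared with the positive part of [- netput], a
   nonnegative function; dropping the negative part only increases the integral. *)
rewrite -mean_netput// integralE.
apply: (@le_trans _ _ (\int[P]_w ((fun w => (- netput W sigma x u T w)%:E)^\+ w))%E).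
  rewrite -[leRHS]adde0 leeD2l// oppe_le0.
  by apply: integral_ge0 => w _; exact: funeneg_ge0.
apply: le_lower_integral => w _; first exact: funepos_ge0.
rewrite funeposE ge_max !lee_fin; have [K0 _ _ _] := KP w; rewrite K0// andbT.
by have := Y0 T w T_ge0; rewrite YE//; lra.
Qed.

End pushing_rate.

(** * Convexity of the mean cost in the drift *)

Section drift_cost_convexity.
Context d (Omega : measurableType d) (R : realType) (P : probability Omega R).
Variables (H : R) (H_range : 2^-1 <= H < 1).
Variables (W : R -> {RV P >-> R}) (W_fbm : fractional_brownian_motion H W).
Variables (C : R -> R) (C_ge0 : forall y, 0 <= y -> 0 <= C y).
Hypothesis C_cont : {within `[0, +oo[, continuous C}.
Hypothesis C_nondecr : nondecreasing_on `[0, +oo[ C.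
Hypothesis C_convex : convex_function (`[0, +oo[%classic : set R^o) C.

Let mC v : measurable_fun [set: Omega] (fun w => (C (max_drifted W v w))%:E).
Proof.
apply/measurable_EFinP; apply: (cost_measurable C_cont).
  exact: (max_drifted_measurable W_fbm).
by move=> w; exact: (max_drifted_ge0 W_fbm).
Qed.

(* A supremum of functions affine in the drift, [max_drifted W v w] is convex
   and nonincreasing in [v], as long as it is finite. *)
Lemma mean_cost_convex a b c t : 0 < a -> 0 < b -> 0 <= t <= 1 ->
  t * a + (1 - t) * b <= c ->
  (mean_cost W C c <= t%:E * mean_cost W C a + (1 - t)%:E * mean_cost W C b)%E.
Proof.
move=> a0 b0 /andP[t0 t1] abc.
have t1' : 0 <= 1 - t by rewrite subr_ge0.
have c0 : 0 < c.
  apply: lt_le_trans abc; have [->|tn0] := eqVneq t 0.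
    by rewrite mul0r add0r subr0 mul1r.
  have t_gt0 : 0 < t by rewrite lt_neqAle eq_sym tn0.
  by rewrite ltr_pwDl ?mulr_gt0//; apply: mulr_ge0 => //; exact: ltW.
have Z0 v w := max_drifted_ge0 W_fbm v w.
have CZ0 v w : (0 <= (C (max_drifted W v w))%:E)%E by rewrite lee_fin C_ge0.
rewrite !mean_costE -!ge0_integralZl_EFin//.
rewrite -ge0_integralD//; last 4 first.
- by move=> w _; rewrite mule_ge0.
- exact: emeasurable_funM.
- by move=> w _; rewrite mule_ge0.
- exact: emeasurable_funM.
apply: ae_ge0_le_integral => //.
- by move=> w _; rewrite adde_ge0// mule_ge0.
- by apply: emeasurable_funD; apply: emeasurable_funM.
have Ab := ae_drift_bounded H_range W_fbm a0.
have Bb := ae_drift_bounded H_range W_fbm b0.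
have Cb := ae_drift_bounded H_range W_fbm c0.
apply: filterS3 Ab Bb Cb => w Ab Bb Cb _.
have Zle : max_drifted W c w <=
    t * max_drifted W a w + (1 - t) * max_drifted W b w.
  apply/(max_drifted_le _ Cb) => s s0.
  have Za := ler_wpM2l t0 (max_drifted_ge Ab s0).
  have Zb := ler_wpM2l t1' (max_drifted_ge Bb s0).
  by apply: le_trans (lerD Za Zb); have := ler_wpM2r s0 abc; lra.
rewrite -!EFinM -EFinD lee_fin.
apply: (le_trans (cost_le C_nondecr (Z0 _ _) Zle)).
have t01 : 0 <= t <= 1 by rewrite t0.
have := @C_convex (Itv01 t0 t1) (max_drifted W a w) (max_drifted W b w).
rewrite !inE/= !in_itv/= !andbT => /(_ (Z0 _ _) (Z0 _ _)).
exact.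
Qed.

End drift_cost_convexity.

(** The pathwise inequality passes through both integrals by [le_lower_integral]; the time integral
    of the cost of [Y] need not be measurable in [w]. *)
Lemma average_cost_minimal d (Omega : measurableType d) (R : realType)
    (P : probability Omega R) (H : R) (W : R -> {RV P >-> R})
    (W_fbm : fractional_brownian_motion H W) (sigma h C : R -> R) (x u : R)
    (C_ge0 : forall y, 0 <= y -> 0 <= C y)
    (C_nondecr : nondecreasing_on `[0, +oo[ C) (hu0 : 0 <= h u)
    (Y K : R -> Omega -> R) : admissible W sigma x u Y K ->
  (average_cost P h C u (reflected W sigma x u) <= average_cost P h C u Y)%E.
Proof.
move=> YK; have W_cont := fbm_path_continuous W_fbm.
apply: (@limsup_pinfty_le _ _ _ 0) => T T0.
have cost0 t w : 0 <= t -> 0 <= h u + C (reflected W sigma x u t w).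
  by move=> t0; rewrite addr_ge0// C_ge0// (reflected_ge0 W_cont).
have itv0 t : `[0, T]%classic t -> 0 <= t by rewrite /= in_itv/= => /andP[].
apply: lee_wpmul2l; first by rewrite lee_fin invr_ge0 ltW.
apply: le_lower_integral => w _.
  by apply: integral_ge0 => t /itv0 t0; rewrite lee_fin cost0.
apply: le_lower_integral => t /itv0 t0; first by rewrite lee_fin cost0.
rewrite lee_fin lerD2l (cost_le C_nondecr)//; first exact: reflected_ge0.
exact: (reflected_minimal W_cont) YK t0.
Qed.

Lemma constrained_controlE (R : realType) (u0 : R) :
  constrained_control u0 = fun m => Num.min m u0.
Proof. by []. Qed.

Theorem theorem4p2 (d : measure_display) (Omega : measurableType d)
    (R : realType) (P : probability Omega R)
    (H : R) (H_range : 2^-1 <= H < 1)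
    (W : R -> {RV P >-> R}) (W_fbm : fractional_brownian_motion H W)
    (sigma : R -> R)
    (sigma_gt0 : forall u, 0 <= u -> 0 < sigma u)
    (sigma_cont : {within `[0, +oo[, continuous sigma})
    (h : R -> R)
    (h_ge0 : forall u, 0 <= u -> 0 <= h u)
    (h_cont : {within `[0, +oo[, continuous h})
    (h_nondecr : nondecreasing_on `[0, +oo[ h)
    (h_convex : strictly_convex_on `[0, +oo[ h)
    (h_pinfty : h u @[u --> +oo] --> +oo)
    (C : R -> R)
    (C_ge0 : forall y, 0 <= y -> 0 <= C y)
    (C_cont : {within `[0, +oo[, continuous C})
    (C_nondecr : nondecreasing_on `[0, +oo[ C)
    (C_convex : convex_function (`[0, +oo[%classic : set R^o) C)
    (C_growth : exists K gamma : R, [/\ 0 < K, 0 < gamma &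
       forall y, 0 <= y -> C y <= K * (1 + y `^ gamma)])
    (f_gt0 : forall u, 0 < u -> 0 < scaled_drift H sigma u)
    (f_lim0 : scaled_drift H sigma u @[u --> 0^'+] --> 0)
    (f_concave : convex_function (`]0, +oo[%classic : set R^o)
       (fun u => - scaled_drift H sigma u))
    (f_nondecr : nondecreasing_on `]0, +oo[ (scaled_drift H sigma))
    (x : R) (x_ge0 : 0 <= x)
    (u0 : R)
    (u0_min : unique (minimizer `]0, +oo[
       (fun u => (h u)%:E + mean_cost W C (scaled_drift H sigma u))%E) u0) :
  (forall m, 0 < m ->
     let u := constrained_control u0 m in
     optimal W sigma h C x m u
       (reflected W sigma x u) (regulator W sigma x u)) /\
  {within `]0, +oo[, continuous (constrained_control u0)} /\
  nondecreasing_on `]0, +oo[ (constrained_control u0).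
Proof.
split; last split.
- have [[u0_gt0 minu0] _] := u0_min.
  move: u0_gt0; rewrite /= in_itv/= andbT => u0_gt0.
  pose phi v := ((h v)%:E + mean_cost W C (scaled_drift H sigma v))%E.
  have phi_u0 v : 0 < v -> (phi u0 <= phi v)%E.
    by move=> v0; apply: minu0; rewrite /= in_itv/= andbT.
  (* [m] lies between [v] and the minimizer, so phi m <= t phi v + (1 - t) phi u0 <= phi v; the
     inequalities are in [\bar R], where phi v may be infinite. *)
  have phi_below v m : 0 < v -> v <= m -> m < u0 -> (phi m <= phi v)%E.
    move=> v0; rewrite le_eqVlt => /orP[/eqP <-//|vm] mu0.
    have vu0 : 0 < u0 - v by rewrite subr_gt0 (lt_trans vm).
    pose t := (u0 - m) / (u0 - v).
    have t0 : 0 < t by rewrite divr_gt0// subr_gt0.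
    have t1 : t < 1 by rewrite ltr_pdivrMr// mul1r ltrD2l ltrN2.
    have mE : m = t * v + (1 - t) * u0.
      by rewrite /t; field; rewrite gt_eqF.
    have t01 : 0 <= t <= 1 by rewrite !ltW.
    have hm : h m <= t * h v + (1 - t) * h u0.
      rewrite mE ltW//; apply: h_convex; rewrite /= ?in_itv/= ?andbT ?ltW ?t0//.
      by rewrite lt_eqF// (lt_trans vm).
    (* Concavity yields an inequality between drifts, which is the form of hypothesis
       [mean_cost_convex] takes: the monotonicity of G is built into that lemma. *)
    have fm : t * scaled_drift H sigma v + (1 - t) * scaled_drift H sigma u0
        <= scaled_drift H sigma m.
      have cvx : - scaled_drift H sigma (t * v + (1 - t) * u0) <=
          t * - scaled_drift H sigma v + (1 - t) * - scaled_drift H sigma u0.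
        have := @f_concave (Itv01 (ltW t0) (ltW t1)) v u0.
        by rewrite !inE/= !in_itv/= !andbT => /(_ v0 u0_gt0).
      by rewrite mE -lerN2 (le_trans cvx)// !mulrN opprD.
    have Gm := mean_cost_convex H_range W_fbm C_ge0 C_cont C_nondecr C_convex
      (f_gt0 _ v0) (f_gt0 _ u0_gt0) t01 fm.
    have t1' : 0 <= 1 - t by rewrite subr_ge0 ltW.
    apply: (@le_trans _ _ (t%:E * phi v + (1 - t)%:E * phi u0)%E).
      have Gv := mean_cost_ge0 W_fbm C_ge0 (scaled_drift H sigma v).
      have Gu := mean_cost_ge0 W_fbm C_ge0 (scaled_drift H sigma u0).
      rewrite /phi !muleDr ?fin_num_adde_defr//.
      rewrite addeACA leeD// -!EFinM -EFinD lee_fin//.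
    apply: (@le_trans _ _ (t%:E * phi v + (1 - t)%:E * phi v)%E).
      by rewrite leeD2l// lee_wpmul2l// phi_u0.
    rewrite -ge0_muleDl; [|by rewrite lee_fin ltW|by rewrite lee_fin].
    by rewrite -EFinD subrKC mul1e.
  have costE v : 0 < v -> average_cost P h C v (reflected W sigma x v) = phi v.
    move=> v0; apply: average_cost_reflected => //.
      exact: sigma_gt0 _ (ltW v0).
    exact: h_ge0 _ (ltW v0).
  move=> m m0; set u := constrained_control u0 m.
  have u_gt0 : 0 < u by rewrite /u /constrained_control; case: ifP.
  have um : u <= m.
    by rewrite /u /constrained_control; case: ltP.
  have feas : feasible W sigma x m u (reflected W sigma x u) (regulator W sigma x u).
    split => //; first exact: (admissible_reflected (fbm_path_continuous W_fbm) (fbm_start W_fbm)).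
    apply: (@le_trans _ _ u%:E); last by rewrite lee_fin.
    by apply: (average_push_regulator H_range W_fbm) => //; exact: sigma_gt0 _ (ltW u_gt0).
  split => //; apply/eqP; rewrite eq_le; apply/andP; split; last first.
    by apply: ereal_inf_lbound; exists u, (reflected W sigma x u), (regulator W sigma x u).
  apply: le_ereal_inf_tmp => _ [v [Y [K [[v0 YK Km] ->]]]].
  have vm : v <= m.
    by rewrite -lee_fin (le_trans _ Km)//; apply: (drift_le_average_push W_fbm) YK.
  have := average_cost_minimal W_fbm C_ge0 C_nondecr (h_ge0 _ (ltW v0)) YK.
  rewrite (costE _ v0) (costE _ u_gt0); apply: le_trans.
  rewrite /u /constrained_control; case: ltP => mu0; last exact: phi_u0.
  exact: phi_below.
- apply: continuous_subspaceT; rewrite constrained_controlE.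
  by move=> m; apply: continuous_min; [exact: cvg_id|exact: cvg_cst].
- rewrite constrained_controlE => a b _ _ ab.
  by rewrite le_min !ge_min ab lexx orbT.
Qed.
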